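(* Let $\zeta$ be a primitive aperiodic substitution on the two-letter alphabet $\{0,1\}$, with substitution matrix $M$, Perron--Frobenius eigenvalue $\theta_1$ and second eigenvalue $\theta_2$. Suppose that $|\theta_2|>1$. Then: (i) the $\mathbb{Z}$-action $(X_\zeta,\sigma)$ is topologically mixing if and only if $\gcd\{|\zeta^n(0)|,|\zeta^n(1)|\}=1$ for all $n\ge 1$; (ii) for any tile lengths $t_0,t_1>0$, the tiling $\mathbb{R}$-action $(X_{\mathcal T},T_g)$ associated with $\zeta$ and $(t_0,t_1)$ is topologically mixing if and only if $t_1/t_0\notin\mathbb{Q}$.
   Context: Substitutions. A substitution on a finite alphabet $\mathcal A$ is a map $\zeta$ from $\mathcal A$ to the set of nonempty finite words over $\mathcal A$, extended to words and sequences by concatenation. $|W|$ is the length of a word $W$ and $\ell_i(W)$ is the number of occurrences of the letter $i$ in $W$. The substitution matrix is $M=(m_{i,j})$ with $m_{i,j}=\ell_i(\zeta(j))$. $\zeta$ is primitive if some power $M^k$ has all entries strictly positive. $X_\zeta\subset\mathcal A^{\mathbb Z}$ is the set of all two-sided sequences every finite subword of which occurs in $\zeta^k(i)$ for $k$ sufficiently large; $\sigma$ is the left shift on $X_\zeta$. $\zeta$ is aperiodic if $X_\zeta$ is infinite. The allowed words are the finite words occurring in elements of $X_\zeta$. For a two-letter alphabet, $\theta_1$ is the Perron--Frobenius eigenvalue of $M$ and $\theta_2$ is the other eigenvalue. Tilings. Given tile lengths $t_i>0$ ($i\in\mathcal A$), let the prototile $\tau_i$ be an interval of length $t_i$ labelled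 by $i$ (labels distinguish congruent tiles). $X_{\mathcal T}$ is the set of all tilings $\mathcal S$ of $\mathbb R$ by translates of the $\tau_i$ such that the sequence of labels along every patch (tiling of a finite interval contained in $\mathcal S$) is an allowed word of $\zeta$. The group $\mathbb R$ acts by $T_g(\mathcal S)=\mathcal S-g$. The topology on $X_{\mathcal T}$ has as basis the sets $X_{P,\epsilon}=\{\mathcal S\in X_{\mathcal T}: \exists y\in(-\epsilon,\epsilon),\ P-y\subset\mathcal S\}$, where $P$ is a patch and $\epsilon>0$. Topological mixing. A continuous action $(X,G)$ of $G=\mathbb Z$ or $\mathbb R$ on a compact metrizable space is topologically mixing if for any nonempty open $U,V\subset X$ there is $R>0$ such that $U\cap T_g(V)\ne\emptyset$ for all $g\in G$ with $|g|\ge R$ (for $G=\mathbb Z$, $T_g=\sigma^g$). *)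

(* Defs.v *)
From HB Require Import structures.
From mathcomp Require Import all_boot all_order all_algebra.
From mathcomp Require Import all_classical all_reals all_analysis.
From mathcomp Require Import lra.

Set Implicit Arguments.
Unset Strict Implicit.
Unset Printing Implicit Defensive.

Import Order.TTheory GRing.Theory Num.Theory.

Local Open Scope classical_set_scope.
Local Open Scope ring_scope.

Definition topologically_mixing (G : numDomainType) (X : topologicalType)
    (T : G -> X -> X) : Prop :=
  forall U V : set X, open U -> open V -> U !=set0 -> V !=set0 ->
    exists2 r : G, 0 < r & forall g : G, r <= `|g| -> U `&` (T g @` V) !=set0.

Record substitution (n : nat) := Substitution {
  subst_fun :> 'I_n -> seq 'I_n;
  subst_neq_nil : forall i, subst_fun i != [::] }.

Definition subst_word n (zeta : substitution n) (w : seq 'I_n) : seq 'I_n :=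
  flatten (map zeta w).

Definition subst_iter n (zeta : substitution n) (k : nat) (i : 'I_n) :
    seq 'I_n :=
  iter k (subst_word zeta) [:: i].

Definition subst_mx n (zeta : substitution n) : 'M[int]_n :=
  \matrix_(i, j) (count_mem i (zeta j))%:Z.

Definition primitive n (zeta : substitution n) : Prop :=
  exists2 k : nat, (0 < k)%N & forall i j, 0 < (subst_mx zeta ^+ k) i j.

(* [theta1] strictly dominates [theta2], and these are all the complex
   eigenvalues of [M], as its characteristic polynomial splits over [R]. *)
Definition perron_frobenius_pair (R : realType) (M : 'M[int]_2)
    (theta1 theta2 : R) : Prop :=
  char_poly (map_mx intr M) = ('X - theta1%:P) * ('X - theta2%:P) /\
  `|theta2| < theta1.

Definition biseq (n : nat) : Type :=
  {ptws int -> discrete_topology 'I_n}.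

Definition subword n (x : biseq n) (m : int) (l : nat) : seq 'I_n :=
  mkseq (fun k => x (m + k%:Z)) l.

Definition subst_space n (zeta : substitution n) : set (biseq n) :=
  [set x | forall (m : int) (l : nat) (i : 'I_n),
     exists K : nat, forall k : nat, (K <= k)%N ->
       infix (subword x m l) (subst_iter zeta k i)].

Definition aperiodic n (zeta : substitution n) : Prop :=
  infinite_set (subst_space zeta).

Definition allowed n (zeta : substitution n) (w : seq 'I_n) : Prop :=
  exists2 x, subst_space zeta x & exists m : int, w = subword x m (size w).

(* [shift g] is the [g]-th power of the left shift. *)
Definition shift n (g : int) (x : biseq n) : biseq n := fun k => x (k + g).

Lemma shift_subst_space n (zeta : substitution n) g x :
  subst_space zeta x -> subst_space zeta (shift g x).
Proof.
move=> xX m l i; have [K HK] := xX (m + g) l i; exists K => k Kk.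
suff -> : subword (shift g x) m l = subword x (m + g) l by exact: HK.
by apply: eq_map => j; rewrite /shift addrAC.
Qed.

Definition subst_shift n (zeta : substitution n) (g : int)
    (x : subst_space zeta) : subst_space zeta :=
  exist _ (shift g (set_val x))
    (mem_set (shift_subst_space g (set_mem (valP x)))).

(* A patch [P] and a radius [epsilon]. *)
Definition base_index (R : realType) (n : nat) : Type :=
  (set (R * 'I_n) * R)%type.
HB.instance Definition _ (R : realType) n := Choice.on (base_index R n).
HB.instance Definition _ (R : realType) n :=
  isPointed.Build (base_index R n) (set0, 0).

Section Tilings.
Variables (R : realType) (n : nat).
Implicit Types (t : 'I_n -> {posnum R}) (S P : set (R * 'I_n)) (y g : R).

(* The pair [(x, i)] encodes the tile [tau_i + x]. *)
Definition tile_support t (p : R * 'I_n) : set R :=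
  [set` `[p.1, p.1 + (t p.2)%:num]].

Definition tile_interior t (p : R * 'I_n) : set R :=
  [set` `]p.1, p.1 + (t p.2)%:num[].

Definition tiles t (D : set R) S : Prop :=
  \bigcup_(p in S) tile_support t p = D /\ trivIset S (tile_interior t).

Definition patch t P : Prop :=
  exists a b : R, a < b /\ tiles t [set` `[a, b]] P.

Definition translate y S : set (R * 'I_n) :=
  [set (p.1 - y, p.2) | p in S].

Definition label_word P (w : seq 'I_n) : Prop :=
  exists s : seq (R * 'I_n),
    [/\ sorted (fun p q => p.1 < q.1) s, P = [set` s] & w = map snd s].

Definition tiling_set (zeta : substitution n) t : set (set (R * 'I_n)) :=
  [set S | tiles t setT S /\
     forall P w, P `<=` S -> patch t P -> label_word P w -> allowed zeta w].

Definition tiling_space (zeta : substitution n) t : Type :=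
  set_type (tiling_set zeta t).

Definition tiling_base (zeta : substitution n) t (b : base_index R n) :
    set (tiling_space zeta t) :=
  [set S | exists2 y : R, - b.2 < y < b.2 & translate y b.1 `<=` set_val S].

Lemma translateD y g S : translate y (translate g S) = translate (g + y) S.
Proof.
rewrite /translate image_comp; apply: eq_imagel => p _ /=.
by rewrite opprD addrA.
Qed.

Lemma translate0 S : translate 0 S = S.
Proof.
by rewrite -[RHS]image_id; apply: eq_imagel => -[a i] _ /=; rewrite subr0.
Qed.

Lemma translateS y S P : S `<=` P -> translate y S `<=` translate y P.
Proof. exact: image_subset. Qed.

Lemma tiles_translate t y (D : set R) S :
  tiles t D S -> tiles t [set x - y | x in D] (translate y S).
Proof.
move=> [<- Striv]; split.
  apply/seteqP; split => x /=.
    move=> [_ [p Sp <-]]; rewrite /tile_support /= in_itv /= => /andP[h1 h2].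
    exists (x + y); last by rewrite addrK.
    exists p => //; rewrite /tile_support /= in_itv /= -lerBlDr h1 /=.
    by rewrite -lerBrDr addrAC.
  move=> [z [p Sp]]; rewrite /tile_support /= in_itv /= => /andP[h1 h2] <-.
  exists (p.1 - y, p.2); first by exists p.
  by rewrite /tile_support /= in_itv /= lerD2r h1 /= addrAC lerD2r.
move=> _ _ [p Sp <-] [q Sq <-] [x]; rewrite /tile_interior /= !in_itv /=.
move=> [/andP[h1 h2] /andP[h3 h4]].
suff -> : p = q by [].
apply: Striv => //; exists (x + y); rewrite /tile_interior /= !in_itv /=.
by split; lra.
Qed.

Lemma patch_translate t y P : patch t P -> patch t (translate y P).
Proof.
move=> [a [b [ab tP]]]; exists (a - y), (b - y); rewrite ltrD2r; split => //.
suff -> : [set` `[a - y, b - y]] = [set x - y | x in [set` `[a, b]]].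
  exact: tiles_translate.
apply/seteqP; split => x /=; rewrite in_itv /=.
  move=> /andP[h1 h2]; exists (x + y); last by rewrite addrK.
  by rewrite /= in_itv /= -lerBlDr h1 -lerBrDr h2.
by move=> [z]; rewrite /= !in_itv /= => /andP[h1 h2] <-; rewrite !lerD2r h1 h2.
Qed.

Lemma label_word_translate y P w : label_word P w -> label_word (translate y P) w.
Proof.
move=> [s [ss -> ->]]; exists [seq (p.1 - y, p.2) | p <- s]; split.
- rewrite sorted_map; apply: sub_sorted ss => p q /=.
  by rewrite ltrD2r.
- apply/seteqP; split => p /=.
    by move=> [q qs <-]; apply/mapP; exists q.
  by move=> /mapP[q qs ->]; exists q.
- by rewrite -map_comp.
Qed.

Lemma translate_tiling_set (zeta : substitution n) t g S :
  tiling_set zeta t S -> tiling_set zeta t (translate g S).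
Proof.
move=> [tS aS]; split.
  have := tiles_translate g tS; congr tiles.
  apply/seteqP; split => // x _; exists (x + g) => //.
  by rewrite addrK.
move=> P w PS pP wP; apply: (aS (translate (- g) P) w).
- have := @translateS (- g) _ _ PS.
  by rewrite translateD subrr translate0.
- exact: patch_translate.
- exact: label_word_translate.
Qed.

Definition tiling_shift (zeta : substitution n) t (g : R)
    (S : tiling_space zeta t) : tiling_space zeta t :=
  exist _ (translate g (set_val S))
    (mem_set (translate_tiling_set g (set_mem (valP S)))).

Lemma tiles_overlap t (D : set R) S p q (x : R) : tiles t D S -> S p -> S q ->
  p.1 < x < p.1 + (t p.2)%:num -> q.1 < x < q.1 + (t q.2)%:num -> p = q.
Proof.
move=> [_ Striv] Sp Sq px qx; apply: Striv => //; exists x.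
by rewrite /tile_interior /= !in_itv.
Qed.

Lemma tile1_patch t p : patch t [set p].
Proof.
exists p.1, (p.1 + (t p.2)%:num); rewrite ltrDl; split => //.
by split; [rewrite bigcup_set1 | move=> i j /= -> ->].
Qed.

(* The tiles of a tiling which lie between two tile endpoints form a patch. *)
Lemma patch_between t S p q : tiles t setT S -> S p -> S q ->
  p.1 < q.1 + (t q.2)%:num ->
  patch t [set r | S r /\ p.1 <= r.1 /\
                   r.1 + (t r.2)%:num <= q.1 + (t q.2)%:num].
Proof.
move=> tS Sp Sq pq; set b := q.1 + _ in pq *.
have tpos i : 0 < (t i)%:num by [].
have inL r : S r -> p.1 < r.1 + (t r.2)%:num -> p.1 <= r.1.
  move=> Sr h; rewrite leNgt; apply/negP => h2.
  set m := Num.min (p.1 + (t p.2)%:num) (r.1 + (t r.2)%:num).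
  have pm : p.1 < m by rewrite lt_min ltrDl tpos.
  have [x1 x2] := midf_lt pm; move: x1 x2; set x := (p.1 + m) / 2 => x1 x2.
  move: x2; rewrite lt_min => /andP[x2 x3].
  have E : p = r.
    by apply: (tiles_overlap (x := x) tS) => //; rewrite ?x1 ?x2 // x3 (lt_trans h2 x1).
  by move: h2; rewrite E ltxx.
have inR r : S r -> r.1 < b -> r.1 + (t r.2)%:num <= b.
  move=> Sr h; rewrite leNgt; apply/negP => h2.
  set m := Num.max q.1 r.1.
  have pm : m < b by rewrite gt_max h andbT /b ltrDl tpos.
  have [x1 x2] := midf_lt pm; move: x1 x2; set x := (m + b) / 2 => x1 x2.
  move: x1; rewrite gt_max => /andP[x1 x3].
  have E : q = r.
    by apply: (tiles_overlap (x := x) tS) => //; rewrite ?x1 ?x2 // x3 (lt_trans x2 h2).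
  by move: h2; rewrite -E ltxx.
exists p.1, b; split => //; split; last first.
  by apply: sub_trivIset tS.2 => r [].
apply/seteqP; split => [x [r [Sr [h1 h2]]]|x].
  rewrite /tile_support /= !in_itv /= => /andP[h3 h4].
  by rewrite (le_trans h1 h3) (le_trans h4 h2).
rewrite /= in_itv /= => /andP[h1 h2].
have [xp|xp] := eqVneq x p.1.
  exists p; last by rewrite /tile_support /= in_itv /= xp lexx lerDl ltW.
  by split => //; split => //; apply: inR.
have [xb|xb] := eqVneq x b.
  exists q; last by rewrite /tile_support /= in_itv /= xb lexx andbT /b lerDl ltW.
  by split => //; split => //; apply: inL.
have h1' : p.1 < x by rewrite lt_neqAle eq_sym xp.
have h2' : x < b by rewrite lt_neqAle xb.
have : [set: R] x by [].
rewrite -tS.1 => -[r Sr]; rewrite /tile_support /= in_itv /= => /andP[h3 h4].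
exists r; last by rewrite /tile_support /= in_itv /= h3.
split => //; split; first by apply: inL => //; exact: lt_le_trans h4.
by apply: inR => //; exact: le_lt_trans h2'.
Qed.

Lemma patch_ends t P : patch t P -> exists p q, [/\ P p, P q,
  p.1 < q.1 + (t q.2)%:num &
  forall r, P r -> p.1 <= r.1 /\ r.1 + (t r.2)%:num <= q.1 + (t q.2)%:num].
Proof.
move=> [a [b [ab [tP _]]]].
have tpos i : 0 < (t i)%:num by [].
have sub r : P r -> a <= r.1 /\ r.1 + (t r.2)%:num <= b.
  move=> Pr; have sr : tile_support t r `<=` [set` `[a, b]].
    by rewrite -tP; exact: bigcup_sup.
  have := sr r.1; have := sr (r.1 + (t r.2)%:num).
  rewrite /tile_support /= !in_itv /= !lexx lerDl (ltW (tpos _)) /=.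
  by move=> /(_ isT)/andP[_ ->] /(_ isT)/andP[-> _].
have : [set` `[a, b]] a by rewrite /= in_itv /= lexx ltW.
have : [set` `[a, b]] b by rewrite /= in_itv /= lexx ltW.
rewrite -tP => -[q Pq]; rewrite /tile_support /= in_itv /= => /andP[q1 q2].
move=> [p Pp]; rewrite /tile_support /= in_itv /= => /andP[p1 p2].
have pa : p.1 = a by apply/eqP; rewrite eq_le p1 (sub _ Pp).1.
have qb : q.1 + (t q.2)%:num = b by apply/eqP; rewrite eq_le q2 (sub _ Pq).2.
by exists p, q; split; rewrite ?pa ?qb.
Qed.

Lemma patch_join t S P1 P2 : tiles t setT S -> patch t P1 -> patch t P2 ->
  P1 `<=` S -> P2 `<=` S ->
  exists Q, [/\ patch t Q, Q `<=` S, P1 `<=` Q & P2 `<=` Q].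
Proof.
move=> tS /patch_ends[p1 [q1 [Pp1 Pq1 pq1 H1]]].
move=> /patch_ends[p2 [q2 [Pp2 Pq2 pq2 H2]]] s1 s2.
pose p := if p1.1 <= p2.1 then p1 else p2.
pose q := if q1.1 + (t q1.2)%:num <= q2.1 + (t q2.2)%:num then q2 else q1.
have [pp1 pp2] : p.1 <= p1.1 /\ p.1 <= p2.1.
  rewrite /p; case: ifPn => [|]; first by rewrite lexx.
  by rewrite -ltNge lexx => /ltW.
have [qq1 qq2] : q1.1 + (t q1.2)%:num <= q.1 + (t q.2)%:num /\
                 q2.1 + (t q2.2)%:num <= q.1 + (t q.2)%:num.
  rewrite /q; case: ifPn => [|]; first by rewrite lexx.
  by rewrite -ltNge lexx => /ltW.
have Sp : S p by rewrite /p; case: ifP => _; [exact: s1|exact: s2].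
have Sq : S q by rewrite /q; case: ifP => _; [exact: s2|exact: s1].
exists [set r | S r /\ p.1 <= r.1 /\ r.1 + (t r.2)%:num <= q.1 + (t q.2)%:num].
split.
- by apply: patch_between => //; rewrite (le_lt_trans pp1) // (lt_le_trans pq1).
- by move=> r [].
- move=> r Pr; have [h1 h2] := H1 _ Pr; split; first exact: s1.
  by rewrite (le_trans pp1 h1) (le_trans h2 qq1).
- move=> r Pr; have [h1 h2] := H2 _ Pr; split; first exact: s2.
  by rewrite (le_trans pp2 h1) (le_trans h2 qq2).
Qed.

Definition tiling_index t : set (base_index R n) :=
  [set b | patch t b.1 /\ 0 < b.2].

Lemma tiling_base_cover (zeta : substitution n) t :
  \bigcup_(b in tiling_index t) @tiling_base zeta t b = setT.
Proof.
apply/seteqP; split => // S _.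
have [[cov _] _] := set_mem (valP S).
have : [set: R] 0 by [].
rewrite -cov => -[p Sp _]; exists ([set p], 1).
  by split => //; exact: tile1_patch.
exists 0; first by rewrite /= ltr01 ltrN10.
by rewrite translate0 => _ ->.
Qed.

Lemma tiling_base_join (zeta : substitution n) t b1 b2
    (S : tiling_space zeta t) :
  tiling_index t b1 -> tiling_index t b2 ->
  tiling_base b1 S -> tiling_base b2 S ->
  exists b, [/\ tiling_index t b, tiling_base b S &
    @tiling_base zeta t b `<=` tiling_base b1 `&` tiling_base b2].
Proof.
case: b1 b2 => [P1 e1] [P2 e2] [/= p1 e1p] [/= p2 e2p].
move=> [y1 /= /andP[l1 u1] s1] [y2 /= /andP[l2 u2] s2].
have [tS _] := set_mem (valP S).
have [Q [pQ QS sQ1 sQ2]] := patch_join tS (patch_translate y1 p1)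
  (patch_translate y2 p2) s1 s2.
pose d := Num.min (Num.min (e1 - y1) (y1 + e1)) (Num.min (e2 - y2) (y2 + e2)).
have d0 : 0 < d by rewrite !lt_min !subr_gt0 u1 u2 -!ltrBlDr !sub0r l1 l2.
exists (Q, d); split => //.
  by exists 0; rewrite /= ?oppr_lt0 ?d0 // translate0.
move=> S' [z /= /andP[z1 z2] sz].
move: z2; rewrite !lt_min => /andP[/andP[a1 a2] /andP[a3 a4]].
move: z1; rewrite ltrNl !lt_min => /andP[/andP[a5 a6] /andP[a7 a8]].
split; [exists (y1 + z)|exists (y2 + z)] => /=.
- by rewrite -ltrBrDl a1 andbT; rewrite ltrNl opprD addrC -ltrBrDr opprK addrC.
- by rewrite -translateD; apply: subset_trans sz; exact: translateS.
- by rewrite -ltrBrDl a3 andbT; rewrite ltrNl opprD addrC -ltrBrDr opprK addrC.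
- by rewrite -translateD; apply: subset_trans sz; exact: translateS.
Qed.

End Tilings.

HB.instance Definition _ (R : realType) (n : nat) (zeta : substitution n)
    (t : 'I_n -> {posnum R}) := Choice.on (tiling_space zeta t).

HB.instance Definition _ (R : realType) (n : nat) (zeta : substitution n)
    (t : 'I_n -> {posnum R}) :=
  isBaseTopological.Build (tiling_space zeta t)
    (@tiling_base_cover R n zeta t) (@tiling_base_join R n zeta t).

Lemma tiling_openE (R : realType) (n : nat) (zeta : substitution n)
    (t : 'I_n -> {posnum R}) :
  open = [set \bigcup_(b in D) @tiling_base R n zeta t b |
           D in [set D | D `<=` tiling_index t]].
Proof. by []. Qed.

(* Main.v *)
Require Import Defs.
From mathcomp Require Import all_boot all_order all_algebra.
From mathcomp Require Import all_classical all_reals all_analysis.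
From mathcomp Require Import lra zify ring.

(** Mixing follows from counting letters. On words of length [n] the left
    eigenvector [phi] of [theta2] is unbounded as [n] grows: otherwise the word
    [zeta^(k+p)(0)], cut in pieces of length [n] comparable to [|zeta^k|], would
    have [phi] much smaller than [theta2^(k+p) phi(0)].  As [phi] has mean zero,
    the number of zeros in words of length [n] ranges over an interval whose
    length tends to infinity, and every interior value is taken by a window that
    starts with 1 and is followed by 0.  The set of populations is thus a tube
    of growing width, in which [x |zeta^k(0)| + y |zeta^k(1)|] reaches every
    large integer (Bezout) or approximates every large real (Dirichlet).

    Conversely, tile positions in a tiling with commensurable lengths stay in
    one class modulo a common divisor.  If [d > 1] divides [|zeta^n(0)|] and
    [|zeta^n(1)|], some word occurs in only one class modulo [d] relative to the
    [zeta^n]-blocks: otherwise each word has two parsings with disjoint cuts,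
    hence [2^j] of them at level [j n], which forces long powers in the language
    and makes it periodic. *)

Set Implicit Arguments.
Unset Strict Implicit.
Unset Printing Implicit Defensive.

Import Order.TTheory GRing.Theory Num.Theory.

Local Open Scope classical_set_scope.

(** * Iterates of a substitution on words, and the language they generate *)

Section Words.
Variables (n : nat) (zeta : substitution n).
Implicit Types (u v w : seq 'I_n) (i j a : 'I_n) (k l : nat).

(** The two words to be placed fix a level [k], and with it the lengths [a], [b] of [zeta^k(0)],
    [zeta^k(1)]. A target [s] is approximated by [p a + q b] with [p] within some [B] of a value
    chosen in advance. As [B] depends on the level, no tube of fixed width would do. The growth
    rests on [|theta2| > 1] through a geometric sum: prefixes of [zeta^k(a)] have weight at most
    [K |theta2|^k], the same order as the whole block, so [p] further levels make the block dominate
    any prefix.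

    Passing to level [k] must not create a common divisor. For the shift this is the coprimality
    assumed at every level; for tilings it holds because the determinant [theta1 theta2] is nonzero,
    so incommensurable lengths stay incommensurable.

    In the converse directions a single open set returning to itself is enough: return times to the
    cylinder of a synchronized word are multiples of [d], and return times to a small neighbourhood
    of a tile position miss the odd multiples of half the common divisor. *)

Definition subst_pow k w := iter k (subst_word zeta) w.

(* On primitive substitutions with a nonempty [subst_space] these are the
   [allowed] words, see [allowedE]. *)
Definition language w : Prop := exists k i, infix w (subst_iter zeta k i).

Lemma subst_iterE k i : subst_iter zeta k i = subst_pow k [:: i].
Proof. by []. Qed.

Lemma subst_iter1 i : subst_iter zeta 1 i = zeta i.
Proof. by rewrite /subst_iter /= /subst_word /= cats0. Qed.

Lemma aperiodic_nonempty : aperiodic zeta -> subst_space zeta !=set0.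
Proof.
move=> aper; apply: contrapT => /set0P/negP/negPn/eqP E; apply: aper.
by rewrite E.
Qed.

Lemma subst_pow_cat k u v : subst_pow k (u ++ v) =
  subst_pow k u ++ subst_pow k v.
Proof.
elim: k => //= k; rewrite /subst_pow => ->.
by rewrite /subst_word map_cat flatten_cat.
Qed.

Lemma subst_pow_cons k i w :
  subst_pow k (i :: w) = subst_iter zeta k i ++ subst_pow k w.
Proof. by rewrite -cat1s subst_pow_cat. Qed.

Lemma subst_pow_nil k : subst_pow k [::] = [::].
Proof. by elim: k => //= k; rewrite /subst_pow => ->. Qed.

Lemma subst_powD k l w : subst_pow (k + l) w = subst_pow k (subst_pow l w).
Proof. exact: iterD. Qed.

Lemma subst_iterD k l i :
  subst_iter zeta (k + l) i = subst_pow k (subst_iter zeta l i).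
Proof. exact: iterD. Qed.

Lemma subst_pow_infix k u v : infix u v ->
  infix (subst_pow k u) (subst_pow k v).
Proof.
by move=> /infixP[p [s ->]]; rewrite !subst_pow_cat; apply: infix_infix.
Qed.

Lemma subst_pow_flatten k w :
  subst_pow k w = flatten (map (subst_iter zeta k) w).
Proof.
by elim: w => [|i w IH]; rewrite ?subst_pow_nil // subst_pow_cons IH.
Qed.

Lemma size_subst_pow k w : size w <= size (subst_pow k w).
Proof.
elim: k => //= k IH; apply: leq_trans IH _; rewrite /subst_pow /=.
elim: (iter _ _ w) => //= i v IH; rewrite /subst_word /= size_cat.
rewrite -add1n leq_add //.
by have := subst_neq_nil zeta i; case: (zeta i).
Qed.

Lemma size_subst_iter_gt0 k i : 0 < size (subst_iter zeta k i).
Proof. exact: (size_subst_pow k [:: i]). Qed.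

Lemma subst_pow_mem k i w : i \in w ->
  infix (subst_iter zeta k i) (subst_pow k w).
Proof. by move=> iw; apply: (subst_pow_infix k (u := [:: i]));
  rewrite infix1s. Qed.

Lemma language_infix u v : infix u v -> language v -> language u.
Proof. by move=> uv [k [i vk]]; exists k, i; apply: infix_trans vk. Qed.

Lemma language_iter k i : language (subst_iter zeta k i).
Proof. by exists k, i; apply: infix_refl. Qed.

Lemma language_pow k w : language w -> language (subst_pow k w).
Proof.
by move=> [l [i wl]]; exists (k + l), i; rewrite subst_iterD;
  exact: subst_pow_infix.
Qed.

Lemma subst_pow_le k w b :
  (forall i, size (subst_iter zeta k i) <= b) ->
  size (subst_pow k w) <= size w * b.
Proof.
move=> H; elim: w => [|i w IH]; first by rewrite subst_pow_nil.
by rewrite subst_pow_cons size_cat mulSn leq_add.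
Qed.

Lemma subst_pow_ge k w b :
  (forall i, b <= size (subst_iter zeta k i)) ->
  size w * b <= size (subst_pow k w).
Proof.
move=> H; elim: w => [|i w IH] //.
by rewrite subst_pow_cons size_cat mulSn leq_add.
Qed.

Definition subst_bound k := \max_i size (subst_iter zeta k i).

Lemma subst_boundP k i : size (subst_iter zeta k i) <= subst_bound k.
Proof. exact: leq_bigmax. Qed.

Lemma subst_boundD k r : subst_bound (k + r) <= subst_bound r * subst_bound k.
Proof.
apply/bigmax_leqP => i _; rewrite subst_iterD.
apply: leq_trans (subst_pow_le _ (@subst_boundP k)) _.
by rewrite leq_mul2r subst_boundP orbT.
Qed.

(** The cut falls in the block of one letter [a]. Asking for [p'] nonempty assigns a cut on a block
    boundary to the block on its left, which exists because [p] is nonempty. *)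
Lemma subst_pow_cut k w p r : subst_pow k w = p ++ r -> p != [::] ->
  exists u a v p' q, [/\ w = u ++ a :: v, p = subst_pow k u ++ p',
    subst_iter zeta k a = p' ++ q, r = q ++ subst_pow k v & p' != [::]].
Proof.
elim: w p => [|a w IH] p; first by rewrite subst_pow_nil; case: p.
rewrite subst_pow_cons => E p0.
have [sp|sp] := leqP (size p) (size (subst_iter zeta k a)).
  exists [::], a, w, p, (drop (size p) (subst_iter zeta k a)).
  have := congr1 (take (size p)) E;
    rewrite [RHS]take_size_cat // takel_cat // => Ep.
  have Ea : subst_iter zeta k a = p ++ drop (size p) (subst_iter zeta k a).
    by rewrite -{1}Ep cat_take_drop.
  rewrite subst_pow_nil; split => //.
  move: E; rewrite {1}Ea -catA => /eqP; rewrite eqseq_cat // => /andP[_ /eqP->].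
  by [].
have := congr1 (take (size (subst_iter zeta k a))) E.
rewrite [LHS]take_size_cat // takel_cat ?(ltnW sp) // => Ea.
move: E; rewrite -{1}(cat_take_drop (size (subst_iter zeta k a)) p) -Ea -catA.
move=> /eqP; rewrite eqseq_cat // eqxx /= => /eqP E.
case: (IH _ E) => [|u [b [v [p' [q [-> Ep Eb Er p'0]]]]]].
  by rewrite -size_eq0 size_drop subn_eq0 -ltnNge.
exists (a :: u), b, v, p', q; split => //.
by rewrite subst_pow_cons -catA -Ep {1}Ea cat_take_drop.
Qed.

End Words.

(** * Block lengths, additive weights and primitivity *)

Section Lengths.
Variables (n : nat) (zeta : substitution n).
Implicit Types (u v w : seq 'I_n) (i j a : 'I_n) (k l : nat).

Lemma subst_pow_block k w p r : subst_pow zeta k w = p ++ r ->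
  subst_bound zeta k < size r ->
  exists u a v q, [/\ w = u ++ a :: v, subst_pow zeta k u = p ++ q,
    size q < subst_bound zeta k & r =
      q ++ subst_iter zeta k a ++ subst_pow zeta k v].
Proof.
move=> E sr; have [p0|p0] := eqVneq p [::].
  case: w E sr => [|a w]; first by rewrite subst_pow_nil p0; case: r.
  rewrite p0 subst_pow_cons /= => <- _; exists [::], a, w, [::].
  by rewrite subst_pow_nil (leq_trans _ (subst_boundP _ k a))
    ?size_subst_iter_gt0.
have [u [a [v [p' [q [Ew Ep Ea Er p'0]]]]]] := subst_pow_cut E p0.
have sq : size q < subst_bound zeta k.
  apply: leq_trans (subst_boundP zeta k a); rewrite Ea size_cat.
  by rewrite -add1n leq_add2r; case: (p') p'0.
case: v Ew Er => [|b v] Ew Er.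
  by move: sr; rewrite Er subst_pow_nil cats0 ltnNge ltnW.
exists (u ++ [:: a]), b, v, q; split => //.
- by rewrite Ew -catA.
- by rewrite subst_pow_cat -[subst_pow zeta k [:: a]]/(subst_iter zeta k a) Ea
  catA -Ep.
- by rewrite Er subst_pow_cons.
Qed.

Section Weights.
Variables (V : nmodType).
Implicit Type f : 'I_n -> V.
Local Open Scope ring_scope.

(** Common form of letter counts, word lengths, tile lengths and the eigenvector [phi]. *)
Definition weight f w : V := \sum_(i <- w) f i.

Lemma weight_nil f : weight f [::] = 0.
Proof. exact: big_nil. Qed.

Lemma weight_cons f i w : weight f (i :: w) = f i + weight f w.
Proof. exact: big_cons. Qed.

Lemma weight1 f i : weight f [:: i] = f i.
Proof. exact: big_seq1. Qed.

Lemma weight_cat f u v : weight f (u ++ v) = weight f u + weight f v.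
Proof. exact: big_cat. Qed.

Lemma weight_subst_pow f k w :
  weight f (subst_pow zeta k w) = weight (fun i =>
    weight f (subst_iter zeta k i)) w.
Proof.
elim: w => [|i w IH]; first by rewrite subst_pow_nil !weight_nil.
by rewrite subst_pow_cons weight_cat IH weight_cons.
Qed.

Lemma weight_count f w : weight f w = \sum_i f i *+ count_mem i w.
Proof.
elim: w => [|i w IH].
  by rewrite weight_nil big1 // => i _; rewrite mulr0n.
rewrite weight_cons IH /=; under [RHS]eq_bigr do rewrite mulrnDr.
rewrite big_split /=; congr (_ + _); rewrite (bigD1 i) //= eqxx mulr1n.
by rewrite big1 ?addr0 // => j /negPf; rewrite eq_sym => ->; rewrite mulr0n.
Qed.

End Weights.

Lemma weight_gt0 (R : numDomainType) (f : 'I_n -> R) w :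
  (forall i, 0 < f i)%R -> w != [::] -> (0 < weight f w)%R.
Proof.
move=> f0; case: w => // i w _; rewrite weight_cons ltr_wpDr //.
by apply: sumr_ge0 => j _; exact: ltW.
Qed.

Lemma weight_subst_iter_gt0 (R : numDomainType) (f : 'I_n -> R) k i :
  (forall i, 0 < f i)%R -> (0 < weight f (subst_iter zeta k i))%R.
Proof.
move=> f0; apply: weight_gt0 => //; rewrite -size_eq0 -lt0n.
exact: size_subst_iter_gt0.
Qed.

Lemma subst_mx_pow k i j :
  ((subst_mx zeta ^+ k) i j = (count_mem i (subst_iter zeta k j))%:Z)%R.
Proof.
elim: k j => [|k IH] j.
  by rewrite expr0 mxE /= addn0 eq_sym; case: eqP.
rewrite exprSr -[(_ * _)%R]/(mulmx _ _) mxE -addn1 subst_iterD.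
have cE w : ((count_mem i w)%:Z = weight (fun c => (c == i)%:Z) w)%R.
  by elim: w => [|c w IHw]; rewrite ?weight_nil // weight_cons -IHw /= PoszD.
rewrite cE weight_subst_pow weight_count; apply: eq_bigr => c _.
rewrite IH -cE mxE.
by rewrite subst_iter1 -mulr_natr natz.
Qed.

Lemma primitive_mem : primitive zeta ->
  exists k0, forall i j, i \in subst_iter zeta k0 j.
Proof.
move=> [k _ H]; exists k => i j; have := H i j; rewrite subst_mx_pow.
by rewrite ltz_nat -has_count has_pred1.
Qed.

Section Primitive.
Variable k0 : nat.
Hypothesis hk0 : forall i j, i \in subst_iter zeta k0 j.

Lemma subst_iter_infix_add k i j :
  infix (subst_iter zeta k i) (subst_iter zeta (k + k0) j).
Proof. by rewrite subst_iterD; apply: subst_pow_mem. Qed.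

Lemma size_subst_iter_mono k i j :
  size (subst_iter zeta k i) <= size (subst_iter zeta (k + k0) j).
Proof. by have := size_infix (subst_iter_infix_add k i j). Qed.

Lemma subst_bound_le_add k j : subst_bound zeta k <= size (subst_iter zeta (k +
  k0) j).
Proof. by apply/bigmax_leqP => i _; exact: size_subst_iter_mono. Qed.

Lemma language_infix_iter w : language zeta w ->
  exists k, forall l j, k <= l -> infix w (subst_iter zeta l j).
Proof.
move=> [k [i wk]]; exists (k + k0) => l j kl.
rewrite -(subnKC kl) subst_iterD; apply: infix_trans wk _.
have [a al] : exists a, a \in subst_iter zeta (l - (k + k0)) j.
  by have := size_subst_iter_gt0 zeta (l - (k + k0)) j;
    case: (subst_iter _ _ _) => // a *; exists a; rewrite mem_head.
by apply: infix_trans (subst_iter_infix_add k i a) _; exact: subst_pow_mem.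
Qed.

End Primitive.
End Lengths.

(** * Finite windows of two-sided sequences *)

Section Subwords.
Variable n : nat.
Implicit Type x : biseq n.
Local Open Scope ring_scope.

Lemma size_subword x m l : size (subword x m l) = l.
Proof. exact: size_mkseq. Qed.

Lemma subwordD x m k l : subword x m (k + l) =
  subword x m k ++ subword x (m + k%:Z) l.
Proof.
rewrite /subword /mkseq iotaD map_cat; congr cat.
rewrite add0n -(addn0 k) iotaDl addn0 -map_comp; apply: eq_map => j /=.
by rewrite PoszD addrA.
Qed.

Lemma subword_shift x g m l : subword (Defs.shift g x) m l =
  subword x (m + g) l.
Proof. by apply: eq_map => j; rewrite /Defs.shift addrAC. Qed.

Lemma subword1 x m : subword x m 1 = [:: x m].
Proof. by rewrite /subword /mkseq /= addr0. Qed.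

Lemma subword_cat x m u v :
  subword x m (size (u ++ v)) = u ++ v <->
  subword x m (size u) = u /\ subword x (m + (size u)%:Z) (size v) = v.
Proof.
rewrite size_cat subwordD; split => [/eqP|[-> ->]] //.
by rewrite eqseq_cat ?size_subword // => /andP[/eqP-> /eqP->].
Qed.

End Subwords.

(** * Allowed words and uniform recurrence *)

Section Language.
Variables (n : nat) (zeta : substitution n) (k0 : nat).
Hypothesis hk0 : forall i j, i \in subst_iter zeta k0 j.

Lemma subst_space_language x m l : subst_space zeta x ->
  language zeta (subword x m l).
Proof.
case: l => [|l] xX.
  by exists 0, (x 0%R : 'I_n); rewrite (size0nil (size_subword x m 0));
    exact: infix0s.
have [K HK] := xX m l.+1 (x 0%R); exists K, (x 0%R); exact: HK.
Qed.

(** Minimality of the shift: a window twice as long as the longest block of level [k] contains a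
    whole block, hence every word occurring in all blocks of that level. The bound [r] is the same
    for all points. *)
Lemma language_recurrent w : language zeta w ->
  exists r, forall x m, subst_space zeta x ->
    exists2 j, j <= r & subword x (m + j%:Z)%R (size w) = w.
Proof.
move=> /(language_infix_iter hk0)[k Hk]; exists (2 * subst_bound zeta k).
move=> x m xX; set r := 2 * _.
have bP a : size (subst_iter zeta k a) <= subst_bound zeta k by exact:
  subst_boundP.
have [K HK] := xX m r (x 0%R).
have := HK _ (leq_addl k K); rewrite subst_iterD => /infixP[p [s E]].
have s0 := bP (x 0%R); have s1 := size_subst_iter_gt0 zeta k (x 0%R).
case: (subst_pow_block E) => [|u [a [v [q [Ew Eu sq Er]]]]].
  by rewrite size_cat size_subword /r; lia.
have /infixP[p1 [s2 Ea]] : infix w (subst_iter zeta k a) by exact: Hk.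
exists (size (q ++ p1)); first by rewrite size_cat; have := bP a;
  rewrite Ea !size_cat /r; lia.
have sz : size (q ++ p1 ++ w) <= r.
  by rewrite !size_cat; have := bP a; rewrite Ea !size_cat /r; lia.
have : subword x m (size (q ++ p1 ++ w)) = q ++ p1 ++ w.
  have := congr1 (take (size (q ++ p1 ++ w))) Er.
  rewrite [LHS]takel_cat ?size_subword // -{1}(subnKC sz) subwordD
    [LHS]take_size_cat ?size_subword //.
  have -> : q ++ subst_iter zeta k a ++ subst_pow zeta k v =
    (q ++ p1 ++ w) ++ s2 ++ subst_pow zeta k v by rewrite Ea -!catA.
  by move=> ->; rewrite take_size_cat.
by rewrite catA => /subword_cat[].
Qed.

Lemma allowedE x w : subst_space zeta x -> allowed zeta w <-> language zeta w.
Proof.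
move=> xX; split => [[y yX [m ->]]|fw]; first exact: subst_space_language.
have [r Hr] := language_recurrent fw; have [j _ Ej] := Hr x 0%R xX.
by exists x => //; exists (0 + j%:Z)%R.
Qed.

End Language.

(** * Synchronization modulo a common divisor of the block lengths *)

Section Recognizability.
Variables (n : nat) (zeta : substitution n).
Implicit Types (u v w q p : seq 'I_n) (i j a : 'I_n) (k l : nat).

Definition parsing k w u p : Prop :=
  language zeta u /\ exists s, subst_pow zeta k u = p ++ w ++ s.

(** A boundary between level-[k] blocks; the offset [t] is counted from the start of the parsed
    word, which sits after [p]. *)
Definition cut_at k u p (t : nat) : Prop :=
  exists u1 u2, u = u1 ++ u2 /\ size (subst_pow zeta k u1) = size p + t.

Lemma subst_pow_prefix_lt k u v w : u ++ w = v -> w != [::] ->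
  size (subst_pow zeta k u) < size (subst_pow zeta k v).
Proof.
move=> <- w0; rewrite subst_pow_cat size_cat -[X in X < _]addn0 ltn_add2l.
by apply: leq_trans (size_subst_pow zeta k w); case: w w0.
Qed.

Lemma parsing_comp k l w u p v q : parsing k w u p -> parsing l u v q ->
  parsing (k + l) w v (subst_pow zeta k q ++ p).
Proof.
move=> [_ [s E]] [Lv [r F]]; split => //; exists (s ++ subst_pow zeta k r).
by rewrite subst_powD F !subst_pow_cat E -!catA.
Qed.

(** A boundary of level [k + l] is the image of a boundary of level [l]. The latter lies within [u]:
    nonempty words have nonempty images, so a boundary outside [u] would be sent strictly outside
    [w]. *)
Lemma cut_at_comp k l w u p v q t : parsing k w u p -> parsing l u v q ->
  t <= size w -> cut_at (k + l) v (subst_pow zeta k q ++ p) t ->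
  exists2 t', t' <= size u &
    cut_at l v q t' /\ size (subst_pow zeta k (take t' u)) = size p + t.
Proof.
move=> [_ [s E]] [_ [r F]] tw [v1 [v2 [Ev]]]; rewrite subst_powD size_cat.
set y := subst_pow zeta l v1 => Ey.
have {}F : y ++ subst_pow zeta l v2 = q ++ u ++ r by rewrite -subst_pow_cat -Ev.
have Eu := congr1 size E; rewrite !size_cat in Eu.
have [yq|yq] := ltnP (size y) (size q).
  have Eq : y ++ drop (size y) q = q.
    rewrite -[RHS](cat_take_drop (size y)); congr cat.
    by rewrite -[LHS](take_size_cat (subst_pow zeta l v2) erefl) F takel_cat //
      ltnW.
  have := subst_pow_prefix_lt k Eq;
    rewrite -size_eq0 size_drop subn_eq0 -ltnNge yq.
  by move=> /(_ isT); lia.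
have [yu|yu] := ltnP (size q + size u) (size y).
  have Eq : (q ++ u) ++ drop (size q + size u) y = y.
    rewrite -[RHS](cat_take_drop (size q + size u)); congr cat.
    rewrite -[LHS](take_size_cat r erefl) -catA -F size_cat.
    by rewrite takel_cat // ltnW.
  have := subst_pow_prefix_lt k Eq;
    rewrite -size_eq0 size_drop subn_eq0 -ltnNge yu.
  move=> /(_ isT); rewrite subst_pow_cat size_cat; lia.
have Ey' : y = q ++ take (size y - size q) u.
  rewrite -[LHS](take_size_cat (subst_pow zeta l v2) erefl) F.
  rewrite take_cat ltnNge yq /= takel_cat //; lia.
exists (size y - size q); first by lia.
split; first by exists v1, v2; split => //; rewrite -/y; lia.
by move: Ey; rewrite {1}Ey' subst_pow_cat size_cat; lia.
Qed.

Section Synchronization.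
Variables (k0 m0 d : nat).
Hypothesis hk0 : forall i j, i \in subst_iter zeta k0 j.
Hypothesis hd : forall i, d %| size (subst_iter zeta m0 i).

Lemma dvdn_size_subst_pow w : d %| size (subst_pow zeta m0 w).
Proof.
elim: w => [|i w IH]; first by rewrite subst_pow_nil dvdn0.
by rewrite subst_pow_cons size_cat dvdn_add.
Qed.

Definition desynchronized w : Prop := exists u p u' p',
  [/\ parsing m0 w u p, parsing m0 w u' p' & size p != size p' %[mod d]].

(* Parsings in different classes mod [d] have no cut in common, so each level
   doubles the number of pairwise disjoint sets of cuts. *)
Lemma disjoint_parsings : (forall w, language zeta w -> desynchronized w) ->
  forall (j : nat) w, language zeta w -> exists f : nat -> seq 'I_n * seq 'I_n,
    (forall i : nat, i < 2 ^ j -> parsing (j * m0) w (f i).1 (f i).2) /\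
    (forall (i i' t : nat), i < 2 ^ j -> i' < 2 ^ j -> t <= size w ->
      cut_at (j * m0) (f i).1 (f i).2 t ->
        cut_at (j * m0) (f i').1 (f i').2 t ->
      i = i').
Proof.
move=> Hw; elim=> [|l IH] w Lw.
  exists (fun=> (w, [::])); split => [i _|i i' t].
    by split => //; exists [::]; rewrite cats0.
  by rewrite expn0 !ltnS !leqn0 => /eqP-> /eqP->.
have [u [p [u' [p' [Pu Pu' pp']]]]] := Hw _ Lw.
have [f [Pf Df]] := IH _ Pu.1; have [f' [Pf' Df']] := IH _ Pu'.1.
pose g (i : nat) := if i < 2 ^ l then ((f i).1, subst_pow zeta m0 (f i).2 ++ p)
  else ((f' (i - 2 ^ l)).1, subst_pow zeta m0 (f' (i - 2 ^ l)).2 ++ p').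
have same v t1 t2 : t1 <= size v -> t2 <= size v ->
    size (subst_pow zeta m0 (take t1 v)) =
      size (subst_pow zeta m0 (take t2 v)) -> t1 = t2.
  wlog t12 : t1 t2 / t1 <= t2.
    by have [t12|/ltnW t12] := leqP t1 t2 => H *; [exact: H|apply/esym/H].
  move=> h1 h2; have [//|t12'] := eqVneq t1 t2.
  have E : take t1 v ++ drop t1 (take t2 v) = take t2 v.
    by rewrite -{1}(take_takel v t12) cat_take_drop.
  have := subst_pow_prefix_lt m0 E.
  rewrite -size_eq0 size_drop subn_eq0 size_takel // -ltnNge ltn_neqAle t12'
    t12.
  by move=> /(_ isT); lia.
(* A common cut would make both [size p + t] and [size p' + t] lengths of level-[m0] images, hence
   divisible by [d], against [pp']. *)
have dj (i i' t : nat) : i < 2 ^ l -> i' < 2 ^ l -> t <= size w ->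
   cut_at (m0 + l * m0) (f i).1 (subst_pow zeta m0 (f i).2 ++ p) t ->
   ~ cut_at (m0 + l * m0) (f' i').1 (subst_pow zeta m0 (f' i').2 ++ p') t.
  move=> il il' tw /(cut_at_comp Pu (Pf _ il) tw)[t1 _ [_ E1]].
  move=> /(cut_at_comp Pu' (Pf' _ il') tw)[t2 _ [_ E2]].
  move: pp'; rewrite -(eqn_modDr t) -E1 -E2.
  by rewrite !(eqP (dvdn_size_subst_pow _)) eqxx.
exists g; rewrite mulSn expnS mul2n -addnn; split => [i il|i i' t il il' tw].
  rewrite /g; case: ltnP => h /=; first by apply: (parsing_comp Pu); exact: Pf.
  by apply: (parsing_comp Pu'); apply: Pf'; lia.
rewrite /g; case: ltnP => h; case: ltnP => h' /=.
- move=> /(cut_at_comp Pu (Pf _ h) tw)[t1 t1u [C1 E1]].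
  move=> /(cut_at_comp Pu (Pf _ h') tw)[t2 t2u [C2 E2]].
  have E := same _ _ _ t1u t2u (etrans E1 (esym E2)); rewrite -E in C2.
  exact: (Df _ _ t1).
- by move=> C1 C2; case: (@dj i (i' - 2 ^ l) t) => //; lia.
- by move=> C1 C2; case: (@dj i' (i - 2 ^ l) t) => //; lia.
- have hl : i - 2 ^ l < 2 ^ l by lia.
  have hl' : i' - 2 ^ l < 2 ^ l by lia.
  move=> /(cut_at_comp Pu' (Pf' _ hl) tw)[t1 t1u [C1 E1]].
  move=> /(cut_at_comp Pu' (Pf' _ hl') tw)[t2 t2u [C2 E2]].
  have E := same _ _ _ t1u t2u (etrans E1 (esym E2)); rewrite -E in C2.
  by have := Df' _ _ _ hl hl' t1u C1 C2; lia.
Qed.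

Lemma language_infix_bounded N : exists r, forall w, language zeta w ->
  size w <= N ->
  forall l i, r <= l -> infix w (subst_iter zeta l i).
Proof.
have H (b : N.-bseq 'I_n) : exists r, language zeta b ->
    forall l i, r <= l -> infix b (subst_iter zeta l i).
  have [Lb|nLb] := pselect (language zeta b); last by exists 0.
  by have [r Hr] := language_infix_iter hk0 Lb; exists r => _ l i; exact: Hr.
have [R HR] := choice H; exists (\max_b R b) => w Lw sw l i Rl.
pose b := Bseq sw; apply: (HR b) => //; apply: leq_trans Rl.
exact: (leq_bigmax b).
Qed.

(** Linear recurrence: one [r] serves all levels. A word no longer than any block of level [k + k0]
    meets at most two consecutive blocks, and the finitely many words of the language with at most
    two letters all occur in [zeta^r(i)]. *)
Lemma language_infix_level : exists r, forall k w i,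
  language zeta w -> size w <= subst_bound zeta k ->
  infix w (subst_iter zeta (k + k0 + r) i).
Proof.
have [r Hr] := language_infix_bounded 2; exists r => k w i Lw sw.
set K := k + k0.
suff [z [Lz sz wz]] : exists z, [/\ language zeta z, size z <= 2 &
    infix w (subst_pow zeta K z)].
  rewrite subst_iterD; apply: infix_trans wz _; apply: subst_pow_infix.
  exact: Hr.
have leK a : size w <= size (subst_iter zeta K a).
  exact: leq_trans sw (subst_bound_le_add hk0 k a).
have [l Hl] := language_infix_iter hk0 Lw.
have := Hl (K + l) i (leq_addl _ _); rewrite subst_iterD.
have := language_iter zeta l i; have := size_subst_iter_gt0 zeta l i.
move: (subst_iter zeta l i) => y y0 Ly /infixP[p [s E]].
have [p0|p0] := eqVneq p [::].
  case: y Ly y0 E => // a y Ly _ E; exists [:: a]; split => //.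
    by apply: language_infix Ly; rewrite -cat1s; apply/prefixW/prefix_prefix.
  move: E; rewrite p0 subst_pow_cons /= => E; apply/prefixW; rewrite prefixE.
  have := congr1 (take (size w)) E;
    rewrite [RHS]take_size_cat // takel_cat // => {2}<-.
  by [].
have [u [a [v [p' [q [Ey _ Ea Ew _]]]]]] := subst_pow_cut E p0.
case: v Ey Ew => [|b v] Ey Ew.
  exists [:: a]; split => //.
    by apply: language_infix Ly; rewrite Ey; apply/suffixW/suffix_suffix.
  rewrite -[subst_pow _ _ _]/(subst_iter zeta K a) Ea; apply/infixP;
    exists p', s.
  by rewrite Ew subst_pow_nil cats0.
exists [:: a; b]; split => //.
  apply: language_infix Ly; rewrite Ey -[[:: a, b & v]]/([:: a; b] ++ v).
  exact: infix_infix.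
have Ew' : w ++ s = (q ++ subst_iter zeta K b) ++ subst_pow zeta K v.
  by rewrite Ew subst_pow_cons catA.
have := congr1 (take (size w)) Ew'; rewrite [LHS]take_size_cat // takel_cat;
  last first.
  by rewrite size_cat (leq_trans (leK b)) // leq_addl.
move=> {}Ew'; rewrite subst_pow_cons Ea -catA.
rewrite -[subst_pow _ _ [:: b]]/(subst_iter zeta K b).
apply/infixP; exists p', (drop (size w) (q ++ subst_iter zeta K b)).
by rewrite {1}Ew' cat_take_drop.
Qed.

Lemma periodic_finite (p : nat) : 0 < p ->
  (forall x m, subst_space zeta x -> x (m + p%:Z)%R = x m) ->
  finite_set (subst_space zeta).
Proof.
case: p => // p _ H.
pose g (f : {ffun 'I_p.+1 -> 'I_n}) : biseq n :=
  fun m => f (inord `|(m %% p.+1%:Z)%Z|).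
apply: (@sub_finite_set _ _ (g @` setT)); last by apply: finite_image;
  exact: finite_finset.
move=> x xX; exists [ffun t : 'I_p.+1 => x (t%:Z)%R : 'I_n] => //.
apply/funext => m; rewrite /g ffunE.
have mge0 := modz_ge0 m (isT : p.+1%:Z != 0 :> int)%R.
have mp := ltz_pmod m (isT : 0 < p.+1%:Z :> int)%R.
rewrite inordK; last by lia.
rewrite gez0_abs // [in RHS](divz_eq m p.+1%:Z).
move: (m %/ _)%Z (m %% _)%Z => c e {m mge0 mp}.
have step (t : nat) e' : x (e' + (t * p.+1)%:Z)%R = x e'.
  elim: t e' => [|t IH] e'; first by rewrite mul0n addr0.
  by rewrite mulSn PoszD addrA addrAC H // IH.
case: c => t.
  by rewrite addrC -PoszM step.
rewrite -{1}(step t.+1 (Negz t * p.+1%:Z + e)%R); congr (x _).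
by rewrite NegzE PoszM mulNr addrAC addNr add0r.
Qed.

Hypothesis d1 : 1 < d.

(* If no word were synchronized, two of the many disjoint parsings at a high
   level would start the same block at a relatively small distance; the
   period of this block would be a period of the whole language. *)
Lemma synchronizing_word : aperiodic zeta -> exists2 w, language zeta w &
  forall u p u' p', parsing m0 w u p -> parsing m0 w u' p' ->
  size p = size p' %[mod d].
Proof.
move=> aper; apply: contrapT => nosync.
have desync w : language zeta w -> desynchronized w.
  move=> Lw; apply: contrapT => nd; apply: nosync;
    exists w => // u p u' p' P P'.
  by apply/eqP/negPn/negP => pp'; apply: nd; exists u, p, u', p'.
have [x xX] := aperiodic_nonempty aper.
have [r Hr] := language_infix_level.
(* Blocks of level 0 have length 1, which [d > 1] does not divide. *)
have m00 : 0 < m0.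
  have := hd (x 0%R); case: (m0) => //=; rewrite dvdn1; lia.
set C := subst_bound zeta (k0 + r).
(* The [2 ^ j > j] parsings will be distributed over [C * n] boxes; the summand [k0 + r] leaves room
   for the levels lost in [language_infix_level]. *)
pose j := C * n + (k0 + r); set K := j * m0.
have jK : j <= K by rewrite leq_pmulr.
pose k := K - (k0 + r); set B := subst_bound zeta k.
have EK : K = k + k0 + r by rewrite /k; lia.
have KB : subst_bound zeta K <= C * B.
  rewrite EK -addnA; exact: subst_boundD.
(* Long enough to contain a whole block of level [K] in every parsing. *)
pose w := subword x 0%R (2 * subst_bound zeta K).+1.
have sw : size w = (2 * subst_bound zeta K).+1 by exact: size_subword.
have Lw : language zeta w by exact: subst_space_language.
have [f [Pf Df]] := disjoint_parsings desync j Lw.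
rewrite -/K in Pf Df.
have bK a : size (subst_iter zeta K a) <= subst_bound zeta K by exact:
  subst_boundP.
have blk (i : 'I_(2 ^ j)) : exists c : nat * 'I_n, [/\ c.1 < subst_bound zeta K,
    cut_at K (f i).1 (f i).2 c.1 & exists w1 w2, size w1 = c.1 /\
      w = w1 ++ subst_iter zeta K c.2 ++ w2].
  have [_ [s E]] := Pf i (ltn_ord i).
  case: (subst_pow_block E) => [|u [a [v [q [Ew Eu sq Er]]]]].
    by rewrite size_cat sw; lia.
  exists (size q, a); split => //=.
    by exists u, (a :: v); split => //; rewrite Eu size_cat.
  exists q; have qw : size (q ++ subst_iter zeta K a) <= size w.
    by rewrite size_cat sw; have := bK a; lia.
  exists (drop (size (q ++ subst_iter zeta K a)) w); split => //.
  rewrite catA -[LHS](cat_take_drop (size (q ++ subst_iter zeta K a)));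
    congr cat.
  rewrite catA in Er; have := congr1 (take (size (q ++ subst_iter zeta K a)))
    Er.
  by rewrite takel_cat // [RHS]take_size_cat.
have [c Hc] := choice blk.
have B0 : 0 < B by exact: leq_trans (size_subst_iter_gt0 zeta k (x 0%R))
  (subst_boundP _ _ _).
have cC (i : 'I_(2 ^ j)) : (c i).1 %/ B < C.
  by have [ci _ _] := Hc i; rewrite ltn_divLR //; exact: leq_trans KB.
(* The box of a parsing: the start of its first whole block at resolution [B], with the letter of
   that block. By [KB] the starts are below [C * B]. *)
pose h (i : 'I_(2 ^ j)) := (Ordinal (cC i), (c i).2).
have : ~ injective h.
  move=> /leq_card; rewrite card_prod !card_ord => le.
  by have := ltn_expl j (isT : 1 < 2); rewrite /j in le *; lia.
move=> /existsNP[i /existsNP[i' /not_implyP[/= hii' /eqP ii']]].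
wlog lt : i i' hii' ii' / (c i).1 < (c i').1.
  move=> W; have [lt|lt|E] := ltngtP (c i).1 (c i').1; first exact: (W i i').
    by apply: (W i' i) => //; rewrite 1?eq_sym.
  have [ci C1 _] := Hc i; have [_ C2 _] := Hc i'; rewrite -E in C2.
  move: ii'; rewrite -val_eqE => /eqP; apply.
  by apply: (Df _ _ _ (ltn_ord i) (ltn_ord i') _ C1 C2); rewrite sw; lia.
case: hii' => /= E1 E2.
pose per := (c i').1 - (c i).1.
have perB : per < B.
  have := divn_eq (c i).1 B; have := divn_eq (c i').1 B; rewrite E1.
  have := ltn_pmod (c i).1 B0; have := ltn_pmod (c i').1 B0; rewrite /per; lia.
have per0 : 0 < per by rewrite subn_gt0.
have [_ _ [w1 [w2 [s1 W1]]]] := Hc i; have [_ _ [w1' [w2' [s1' W1']]]] := Hc i'.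
set Z := subst_iter zeta K (c i).2 in W1; rewrite -E2 -/Z in W1'.
have perZ y t : t + per < size Z -> nth y Z (t + per) = nth y Z t.
  move=> tper.
  transitivity (nth y w ((c i').1 + t)).
    rewrite W1 nth_cat s1 ltnNge; have -> : (c i).1 <= (c i').1 + t by lia.
    rewrite /= nth_cat; have -> : (c i').1 + t - (c i).1 =
      t + per by rewrite /per; lia.
    by rewrite tper.
  rewrite W1' nth_cat s1' ltnNge leq_addr /= nth_cat addKn.
  by rewrite (leq_ltn_trans (leq_addr per t)).
apply: aper; apply: (periodic_finite per0) => y m yX.
have Lz : language zeta (subword y m per.+1) by exact: subst_space_language.
have := Hr k _ (c i).2 Lz; rewrite size_subword -EK -/Z =>
  /(_ perB)/infixP[z1 [z2 EZ]].
have sZ : size Z = size z1 + per.+1 +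
  size z2 by rewrite EZ !size_cat size_subword addnA.
have nthZ t : t <= per -> nth (y 0%R : 'I_n) Z (size z1 + t) = y (m + t%:Z)%R.
  move=> tper; rewrite EZ nth_cat ifN -?leqNgt ?leq_addr // addKn nth_cat
    size_subword ltnS tper.
  by rewrite nth_mkseq.
have := perZ (y 0%R) (size z1); rewrite sZ => /(_ _)/=.
have := nthZ 0 (leq0n _); rewrite addn0 addr0 => ->.
by rewrite nthZ // => -> //; lia.
Qed.

(** The stretch of [x] covering both occurrences lies in a single image [zeta^m0(u)]. This yields
    two parsings of [w] over the same [u], whose prefixes differ in length by [g]. *)
Lemma recurrence_dvdn w : language zeta w ->
  (forall u p u' p', parsing m0 w u p -> parsing m0 w u' p' ->
    size p = size p' %[mod d]) ->
  forall x m g, subst_space zeta x -> subword x m (size w) = w ->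
    subword x (m + g%:Z)%R (size w) = w -> d %| g.
Proof.
move=> Lw sync x m g xX E1 E2.
have Lg : language zeta (subword x m (g +
  size w)) by exact: subst_space_language.
have [l Hl] := language_infix_iter hk0 Lg.
have := Hl _ (x 0%R) (leq_addl m0 l); rewrite subst_iterD => /infixP[p [s E]].
have Lu : language zeta (subst_iter zeta l (x 0%R)) by exact: language_iter.
have P2 : parsing m0 w (subst_iter zeta l (x 0%R)) (p ++ subword x m g).
  by split => //; exists s; rewrite E subwordD E2 -!catA.
have P1 : parsing m0 w (subst_iter zeta l (x 0%R)) p.
  split => //; exists (subword x (m + (size w)%:Z)%R g ++ s).
  by rewrite E addnC subwordD E1 -!catA.
have /eqP := sync _ _ _ _ P1 P2; rewrite size_cat size_subword.
by rewrite -{1}[size p]addn0 eqn_modDl mod0n eq_sym.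
Qed.

End Synchronization.
End Recognizability.

Lemma bernoulli (R : realDomainType) (x : R) (l : nat) :
  (0 <= x -> l%:R * x + 1 <= (x + 1) ^+ l)%R.
Proof.
move=> x0; elim: l => [|l IH]; first by rewrite mul0r add0r expr0.
rewrite exprSr mulrDr mulr1; apply: le_trans (lerD (ler_wpM2r x0 IH) IH).
rewrite -natr1 -subr_ge0 (_ : _ - _ = l%:R * x * x)%R; last by ring.
by rewrite !mulr_ge0.
Qed.

(** * Words of equal length with widely different numbers of zeros *)

Section TwoLetters.
Variable zeta : substitution 2.
Implicit Types (u v w : seq 'I_2) (i j a b : 'I_2) (k l : nat).
Local Open Scope ring_scope.

Lemma ord2P i : i = 0 \/ i = 1.
Proof.
by case: i => [[|[|?]] hi] //; [left|right]; apply: val_inj.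
Qed.

Lemma weight2 (V : nmodType) (f : 'I_2 -> V) w :
  weight f w = f 0 *+ count_mem 0 w + f 1 *+ count_mem 1 w.
Proof.
rewrite weight_count !big_ord_recl big_ord0 addr0 (_ : lift _ _ = 1) //.
exact: val_inj.
Qed.

Lemma weight2M (R : pzSemiRingType) (f : 'I_2 -> R) w :
  weight f w = f 0 * (count_mem 0%R w)%:R + f 1 * (count_mem 1%R w)%:R.
Proof. by rewrite weight2 -[f 0 *+ _]mulr_natr -[f 1 *+ _]mulr_natr. Qed.

Lemma count_mem01 w : (count_mem 0%R w + count_mem 1%R w = size w)%N.
Proof.
elim: w => //= i w <-; case: (ord2P i) => -> /=; lia.
Qed.

(** Demanded for every large [n], because the length of the window will be dictated by the target
    distance. *)
Definition unbounded_width : Prop := forall C : nat, exists n0 : nat,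
  forall n, (n0 <= n)%N ->
  exists w w', [/\ language zeta w, language zeta w', size w = n, size w' = n &
    (count_mem 0%R w' + C <= count_mem 0%R w)%N].

(** On two letters, if [a] were missing from [zeta(b)], every iterate of [b] would consist of [b]
    alone. *)
Lemma primitive_count k0 : (forall i j, i \in subst_iter zeta k0 j) ->
  forall a b, a != b -> (0 < count_mem a (zeta b))%N.
Proof.
move=> hk0 a b ab; rewrite -has_count has_pred1; apply: contraT => na.
have onlyb k c : c \in subst_iter zeta k b -> c = b.
  elim: k c => [|k IH] c; first by rewrite inE => /eqP.
  rewrite -(add1n k) subst_iterD subst_pow_flatten =>
    /flattenP[s /mapP[e ek ->]].
  rewrite (IH _ ek) subst_iter1 => cz.
  case: (ord2P a) (ord2P b) (ord2P c) ab na cz => -> [] -> [] -> //.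
  - by move=> _ /negP h /h.
  - by move=> _ /negP h /h.
by move: ab; rewrite (onlyb _ _ (hk0 a b)) eqxx.
Qed.

Section Primitive.
Variable k0 : nat.
Hypothesis hk0 : forall i j, i \in subst_iter zeta k0 j.

Lemma size_subst_iter_homo k l i : (k <= l)%N ->
  (size (subst_iter zeta k i) <= size (subst_iter zeta l i))%N.
Proof.
by move=> /subnK<-; rewrite subst_iterD; exact: size_subst_pow.
Qed.

(** Each image under [zeta^k0] contains both letters, so [zeta^k0] at least doubles lengths. *)
Lemma subst_iter_unbounded N : exists k, forall l i, (k <= l)%N ->
  (N <= size (subst_iter zeta l i))%N.
Proof.
have two i : (2 <= size (subst_iter zeta k0 i))%N.
  rewrite -(count_mem01 (subst_iter zeta k0 i)).
  by apply: (@leq_add 1 1); rewrite -has_count has_pred1.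
have pw q i : (2 ^ q <= size (subst_iter zeta (q * k0) i))%N.
  elim: q i => [|q IH] i; first by rewrite expn0 size_subst_iter_gt0.
  rewrite mulSn [(k0 + _)%N]addnC subst_iterD expnS.
  by apply: leq_trans (subst_pow_ge _ IH); rewrite leq_mul2r two orbT.
exists (N * k0)%N => l i Nl; apply: leq_trans (size_subst_iter_homo i Nl).
by apply: leq_trans (pw N i); apply/ltnW/ltn_expl.
Qed.

(** [k] is the least level all of whose blocks have length at least [n]. Some block of level [k - 1]
    is then shorter than [n], and by primitivity no block of level [k - 1 - k0] exceeds it; the
    remaining [k0 + p + 1] levels cost a factor independent of [n]. *)
Lemma subst_iter_scale (N p : nat) : (k0 <= N)%N ->
  forall n, (subst_bound zeta N < n)%N ->
  exists k, [/\ (N <= k)%N, forall i, (n <= size (subst_iter zeta k i))%N &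
    (subst_bound zeta (k + p) <= subst_bound zeta (k0 + p).+1 * n)%N].
Proof.
move=> k0N n Nn.
pose P k := [forall i, (n <= size (subst_iter zeta k i))%N].
have exP : exists k, P k.
  have [k Hk] := subst_iter_unbounded n; exists k; apply/forallP => i;
    exact: Hk.
case: (ex_minnP exP) => k /forallP Pk mink.
have Nk : (N < k)%N.
  rewrite ltnNge; apply/negP => kN; move: Nn; rewrite ltnNge.
  by rewrite (leq_trans (Pk 0%R)) // (leq_trans (size_subst_iter_homo 0%R kN))
    // subst_boundP.
exists k; split => //; first exact: ltnW.
have : ~~ P k.-1 by apply/negP => /mink; case: (k) Nk => //= k'; rewrite ltnn.
rewrite negb_forall => /existsP[i]; rewrite -ltnNge => ni.
have -> : (k + p = (k.-1 - k0) + (k0 + p).+1)%N by lia.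
apply: leq_trans (subst_boundD _ _ _) _; rewrite leq_mul2l; apply/orP; right.
apply: leq_trans (ltnW ni); have {2}-> : k.-1 = (k.-1 - k0 + k0)%N by lia.
exact: subst_bound_le_add.
Qed.

Section Eigenvector.
Variables (R : realType) (theta : R) (phi : 'I_2 -> R).
Hypothesis theta_gt1 : 1 < `|theta|.
Hypothesis phi_eigen : forall i, weight phi (zeta i) = theta * phi i.
Hypothesis phi0 : 0 < phi 0.
Hypothesis phi1 : phi 1 < 0.

Lemma weight_eigen k w : weight phi (subst_pow zeta k w) =
  theta ^+ k * weight phi w.
Proof.
elim: k => [|k IH]; first by rewrite expr0 mul1r.
rewrite -(add1n k) subst_powD exprD expr1 -mulrA -IH.
elim: (subst_pow zeta k w) => [|i v IHv].
  by rewrite subst_pow_nil !weight_nil mulr0.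
rewrite subst_pow_cons weight_cat weight_cons mulrDr IHv; congr (_ + _).
by rewrite subst_iter1.
Qed.

Lemma ler_norm_weight w : `|weight phi w| <= weight (fun i => `|phi i|) w.
Proof. exact: ler_norm_sum. Qed.

(** A nonempty prefix of [zeta^(k+1)(a)] is [zeta^k] of a prefix of [zeta(a)] followed by a prefix
    of a level-[k] block. The bound is thus a geometric sum, and [K] is chosen so that
    [S + K <= K * |theta|], possible because [|theta| > 1]. *)
Lemma weight_prefix_bound : exists2 K : R, 0 < K & forall k a u v,
  subst_iter zeta k a = u ++ v -> `|weight phi u| <= K * `|theta| ^+ k.
Proof.
pose nphi i := `|phi i|.
have w0 w : 0 <= weight nphi w by apply: sumr_ge0 => i _; exact: normr_ge0.
pose S := \sum_a weight nphi (zeta a) + \sum_a nphi a.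
have nn i : 0 <= nphi i by exact: normr_ge0.
have S1 a : weight nphi (zeta a) <= S.
  rewrite /S (bigD1 a) //= -addrA lerDl.
  by apply: addr_ge0; apply: sumr_ge0.
have S2 a : nphi a <= S.
  rewrite /S [X in _ + X](bigD1 a) //= addrCA lerDl.
  by apply: addr_ge0; apply: sumr_ge0.
have S0 : 0 < S by apply: lt_le_trans (S2 0); rewrite normr_gt0 gt_eqF.
have t1 : 0 < `|theta| - 1 by rewrite subr_gt0.
pose K := S / (`|theta| - 1) + S.
have K0 : 0 < K by rewrite addr_gt0 // divr_gt0.
have KS : S + K <= K * `|theta|.
  rewrite -lerBrDr -{2}[K]mulr1 -mulrBr mulrDl divfK ?gt_eqF //.
  by rewrite lerDl mulr_ge0 // ltW.
exists K => // k; elim: k => [|k IH] a u v E.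
  rewrite expr0 mulr1; apply: le_trans (ler_norm_weight u) _.
  apply: (@le_trans _ _ (weight nphi [:: a])).
    by rewrite -[[:: a]]/(subst_iter zeta 0 a) E weight_cat lerDl.
  by rewrite weight1 (le_trans (S2 a)) // lerDr divr_ge0 // ltW.
have [->|u0] := eqVneq u [::].
  by rewrite weight_nil normr0 mulr_ge0 // ?ltW // exprn_ge0.
move: E; rewrite -(addn1 k) subst_iterD => /subst_pow_cut/(_ u0).
move=> [x [b [y [p [q [E -> Eb _ _]]]]]].
rewrite weight_cat (le_trans (ler_normD _ _)) // weight_eigen normrM normrX.
apply: (@le_trans _ _ ((S + K) * `|theta| ^+ k)); last first.
  by rewrite addn1 exprS mulrA ler_wpM2r // exprn_ge0.
rewrite mulrDl lerD //; last exact: IH Eb.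
rewrite mulrC ler_wpM2r ?exprn_ge0 // (le_trans (ler_norm_weight _)) //.
apply: le_trans (S1 a).
have -> : zeta a = x ++ b :: y by rewrite -E subst_iter1.
by rewrite weight_cat lerDl.
Qed.

Lemma weight_pieces (f : 'I_2 -> R) (n : nat) (c : R) :
  (forall w, language zeta w -> size w = n -> c <= weight f w) ->
  forall q w, language zeta w -> size w = (q * n)%N -> q%:R * c <= weight f w.
Proof.
move=> H; elim=> [|q IH] w Lw sw.
  by rewrite (size0nil sw) weight_nil mul0r.
rewrite -(cat_take_drop n w) weight_cat -natr1 mulrDl mul1r addrC lerD //.
  apply: IH; last by rewrite size_drop sw mulSn addKn.
  by apply: language_infix Lw; exact: infix_drop.
apply: H; first by apply: language_infix Lw; exact: infix_take.
by rewrite size_takel // sw mulSn leq_addr.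
Qed.

Lemma weight_unbounded (C : R) : exists n0 : nat, forall n, (n0 <= n)%N ->
  exists w, [/\ language zeta w, size w = n & C < `|weight phi w|].
Proof.
wlog C0 : C / 0 < C.
  move=> W; have [n0 H] := W (`|C| + 1) (ltr_wpDl (normr_ge0 C) ltr01).
  exists n0 => n /H[w [Lw sw h]]; exists w; split => //; apply: le_lt_trans h.
  by rewrite (le_trans (ler_norm C)) // lerDl.
have [K K0 HK] := weight_prefix_bound.
have grow (A : R) : exists k, forall l, (k <= l)%N -> A < `|theta| ^+ l.
  exists (Num.truncn (`|A| / (`|theta| - 1))).+1 => l kl.
  have t1 : 0 < `|theta| - 1 by rewrite subr_gt0.
  rewrite -[`|theta|](subrK 1); apply: lt_le_trans (bernoulli l (ltW t1)).
  apply: (le_lt_trans (ler_norm A)); apply: ltr_wpDr => //;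
    rewrite -ltr_pdivrMr //.
  by apply: lt_le_trans (truncnS_gt _) _; rewrite ler_nat.
(* [p] levels make the whole word weigh at least twice the prefix bound, at the price of at most [D]
   pieces whatever [n] is; from level [k1] on, [D] pieces of weight at most [C] stay below one
   prefix bound. *)
have [p Hp] := grow (2 * K / phi 0).
pose D := subst_bound zeta (k0 + p).+1.
have [k1 Hk1] := grow (D%:R * C / K).
exists (subst_bound zeta (maxn k0 k1)).+1 => n n0n; apply: contrapT => nw.
have Hn w : language zeta w -> size w = n -> `|weight phi w| <= C.
  by move=> Lw sw; rewrite leNgt; apply/negP => h; apply: nw; exists w.
have [k [Nk Pk Bk]] := subst_iter_scale p (leq_maxl k0 k1) n0n.
pose Z := subst_iter zeta (k + p) 0.
have tk0 l : 0 < `|theta| ^+ l by rewrite exprn_gt0 // (lt_trans ltr01).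
have Zlow : 2 * K * `|theta| ^+ k <= `|weight phi Z|.
  rewrite /Z subst_iterE weight_eigen weight1 normrM normrX (gtr0_norm phi0).
  rewrite exprD -[leRHS]mulrA [leRHS]mulrC ler_wpM2r ?(ltW (tk0 _)) //.
  by rewrite -ler_pdivrMr //; apply/ltW/Hp.
pose r := (size Z %% n)%N.
have n0 : (0 < n)%N by exact: leq_trans n0n.
(* The remainder is cut off at the front: as [r < n], it is a prefix of a block of level [k]. *)
have Zr : `|weight phi (take r Z)| <= K * `|theta| ^+ k.
  have [b [y Eb]] : exists b y, subst_iter zeta p 0 = b :: y.
    by have := size_subst_iter_gt0 zeta p (0 : 'I_2);
      case: subst_iter => // b y _; exists b, y.
  have sr : (r <= size (subst_iter zeta k b))%N.
    by apply: leq_trans (Pk b); rewrite ltnW // ltn_mod.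
  rewrite /Z subst_iterD Eb subst_pow_cons takel_cat //.
  by apply: (HK k b _ (drop r (subst_iter zeta k b))); rewrite cat_take_drop.
have LZ : language zeta (drop r Z) by apply: language_infix (language_iter zeta
  (k + p) 0); exact: infix_drop.
have sZ : size (drop r Z) = (size Z %/ n * n)%N.
  by rewrite size_drop {1}(divn_eq (size Z) n) addnK.
have qD : (size Z %/ n <= D)%N.
  rewrite -(mulnK D n0) leq_div2r //; apply: leq_trans Bk; exact: subst_boundP.
have Zd : `|weight phi (drop r Z)| <= D%:R * C.
  apply: (@le_trans _ _ ((size Z %/ n)%:R * C)); last first.
    by rewrite ler_wpM2r ?(ltW C0) // ler_nat.
  rewrite ler_norml -[X in _ && X]lerN2 -mulrN -[- weight phi _]sumrN.
  apply/andP; split.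
    by apply: (weight_pieces (n := n)) => // w Lw sw; have := Hn _ Lw sw;
      rewrite ler_norml => /andP[].
  apply: (@weight_pieces (fun i => - phi i) n) => // w Lw sw.
  by rewrite /weight sumrN lerN2; have := Hn _ Lw sw;
    rewrite ler_norml => /andP[].
have Zup : `|weight phi Z| <= K * `|theta| ^+ k + D%:R * C.
  by rewrite -(cat_take_drop r Z) weight_cat (le_trans (ler_normD _ _)) // lerD.
have := Hk1 k (leq_trans (leq_maxr _ _) Nk).
rewrite ltr_pdivrMr // => h.
by have := le_trans Zlow Zup; move: h; lra.
Qed.

(** If all words of length [n] weighed at least [C], long words would have positive weight,
    proportional to the number of pieces up to a bounded remainder. Even exponents appear because
    [theta] may be negative. *)
Lemma weight_mean (f : 'I_2 -> R) a (n : nat) (C : R) : (0 < n)%N -> 0 < C ->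
  (forall k, weight f (subst_iter zeta (2 * k) a) <= 0) ->
  exists w, [/\ language zeta w, size w = n & weight f w < C].
Proof.
move=> n0 C0 fa; apply: contrapT => nw.
have Hn w : language zeta w -> size w = n -> C <= weight f w.
  by move=> Lw sw; rewrite leNgt; apply/negP => h; apply: nw; exists w.
pose S := `|f 0| + `|f 1|.
have [q Hq] : exists q : nat, n%:R * S < q%:R * C.
  exists (Num.truncn (n%:R * S / C)).+1; rewrite -ltr_pdivrMr //.
  exact: truncnS_gt.
have [k Hk] := subst_iter_unbounded ((q + 1) * n).
pose Z := subst_iter zeta (2 * k) a; pose r := (size Z %% n)%N.
have sZ : ((q + 1) * n <= size Z)%N by apply: Hk; rewrite leq_pmull.
have LZ : language zeta (drop r Z) by apply: language_infix (language_iter zeta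
  _ a); exact: infix_drop.
have E : size (drop r Z) = (size Z %/ n * n)%N.
  by rewrite size_drop {1}(divn_eq (size Z) n) addnK.
have h1 := weight_pieces Hn LZ E.
have fS i : - S <= f i.
  apply: (@le_trans _ _ (- `|f i|)); last by rewrite lerNl -normrN ler_norm.
  by rewrite lerN2 /S; case: (ord2P i) => ->; rewrite ?lerDl ?lerDr.
have wS w : - ((size w)%:R * S) <= weight f w.
  elim: w => [|i w IH]; first by rewrite weight_nil mul0r oppr0.
  by rewrite weight_cons /= -natr1 mulrDl mul1r opprD addrC lerD.
have h2 := wS (take r Z).
have rn : (size (take r Z))%:R * S <= n%:R * S.
  rewrite ler_wpM2r ?addr_ge0 // ler_nat size_take_min geq_min.
  by rewrite [(r <= n)%N]ltnW // ltn_mod.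
have qq : q%:R * C <= (size Z %/ n)%:R * C.
  rewrite ler_wpM2r ?(ltW C0) // ler_nat leq_divRL // (leq_trans _ sZ) //.
  by rewrite leq_mul2r leq_addr orbT.
have := fa k; rewrite -/Z -(cat_take_drop r Z) weight_cat leNgt => /negP; apply.
by move: h1 h2 rn qq Hq; lra.
Qed.

Lemma count_width : unbounded_width.
Proof.
move=> C.
(* At equal length, each extra zero changes the weight by [phi 0 - phi 1]; the summand 1 keeps [E]
   positive when [C = 0]. *)
pose E := C%:R * (phi 0 - phi 1) + 1.
have d0 : 0 < phi 0 - phi 1 by rewrite subr_gt0 (lt_trans phi1).
have E0 : 0 < E by rewrite ltr_wpDl // mulr_ge0 // ltW.
have t2 k : 0 <= theta ^+ (2 * k) by rewrite exprM exprn_ge0 // sqr_ge0.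
have [n0 H] := weight_unbounded (2 * E).
exists n0.+1 => n n0n.
have npos : (0 < n)%N by exact: leq_trans n0n.
have key w w' : size w = n -> size w' = n ->
  E <= weight phi w - weight phi w' ->
    (count_mem 0%R w' + C <= count_mem 0%R w)%N.
  move=> sw sw'; rewrite !weight2M -(ler_nat R) natrD.
  rewrite /E.
  have e2 : (count_mem 0 w)%:R + (count_mem 1 w)%:R = n%:R :> R.
    by rewrite -natrD count_mem01 sw.
  have e1 : (count_mem 0 w')%:R + (count_mem 1 w')%:R = n%:R :> R.
    by rewrite -natrD count_mem01 sw'.
  move: e1 e2; set x := (count_mem 0 w)%:R; set x' := (count_mem 0 w')%:R.
  set y := (count_mem 1 w)%:R; set y' := (count_mem 1 w')%:R => e1 e2 h.
  have ey : y = n%:R - x by rewrite -e2 addrC addKr.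
  have ey' : y' = n%:R - x' by rewrite -e1 addrC addKr.
  have : C%:R * (phi 0 - phi 1) <= (x - x') * (phi 0 - phi 1).
    by move: h; rewrite ey ey'; lra.
  by rewrite ler_pM2r // lerBrDl.
have [w [Lw sw h]] := H n (ltnW n0n).
have [h0|h0] := leP 0 (weight phi w).
  rewrite ger0_norm // in h.
  have [|w' [Lw' sw' h']] := @weight_mean phi 1 n E npos E0.
    move=> k; rewrite subst_iterE weight_eigen weight1.
    by rewrite mulr_ge0_le0 // ltW.
  by exists w, w'; split => //; apply: key => //; move: h h'; lra.
rewrite ltr0_norm // in h.
have [|w' [Lw' sw' h']] := @weight_mean (fun i => - phi i) 0 n E npos E0.
  move=> k; rewrite /weight sumrN -/(weight phi _) subst_iterE weight_eigen
    weight1.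
  by rewrite oppr_le0 mulr_ge0 // ltW.
rewrite /weight sumrN -/(weight phi _) in h'.
by exists w', w; split => //; apply: key => //; move: h h'; lra.
Qed.

End Eigenvector.
End Primitive.
End TwoLetters.

(** * The eigenvector of the second eigenvalue *)

Section Spectrum.
Variables (R : realType) (zeta : substitution 2) (theta1 theta2 : R) (k0 : nat).
Hypothesis hk0 : forall i j, i \in subst_iter zeta k0 j.
Hypothesis theta12 : perron_frobenius_pair (subst_mx zeta) theta1 theta2.
Local Open Scope ring_scope.

Let m (i j : 'I_2) : R := (count_mem i (zeta j))%:R.

Lemma trace_det : theta1 + theta2 = m 0 0 + m 1 1 /\
  theta1 * theta2 = m 0 0 * m 1 1 - m 0 1 * m 1 0.
Proof.
have [E _] := theta12.
set A := map_mx intr (subst_mx zeta) in E.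
have AE i j : A i j = m i j by rewrite !mxE.
have l1 : lift (ord0 : 'I_2) (ord0 : 'I_1) = 1 by exact: val_inj.
have l2 : lift (1 : 'I_2) (0 : 'I_1) = 0 by exact: val_inj.
move: A E AE => A E AE.
have tr : \tr A = m 0 0 + m 1 1.
  by rewrite /mxtrace !big_ord_recl big_ord0 addr0 l1 !AE.
have dt : \det A = m 0 0 * m 1 1 - m 0 1 * m 1 0.
  rewrite (expand_det_row _ 0) !big_ord_recl big_ord0 addr0 /cofactor !det_mx11.
  by rewrite !mxE l1 l2 /= expr0 expr1 mul1r mulN1r mulrN !AE.
have := @char_poly_trace _ 2 A isT; have := char_poly_det A.
rewrite E tr dt /= => e0 e1; split.
  by move: e1; rewrite coefM !big_ord_recl big_ord0 /= !coefB !coefX !coefC /=;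
    lra.
by move: e0; rewrite coefM !big_ord_recl big_ord0 /= !coefB !coefX !coefC /=;
  lra.
Qed.

(** The vector is [(m 1 0, theta2 - m 0 0)]. The characteristic polynomial takes the value
    [- m 0 1 * m 1 0 < 0] at [m 0 0], so [m 0 0] lies strictly between the eigenvalues, which gives
    the sign of [phi 1]. *)
Lemma second_eigenvector : exists phi : 'I_2 -> R,
  [/\ forall i, weight phi (zeta i) = theta2 * phi i, 0 < phi 0 & phi 1 < 0].
Proof.
have [tr dt] := trace_det; have [_ lt] := theta12.
have m01 : 0 < m 0 1 by rewrite ltr0n; exact: (primitive_count hk0).
have m10 : 0 < m 1 0 by rewrite ltr0n; exact: (primitive_count hk0).
have t21 : theta2 < theta1 by apply: le_lt_trans (ler_norm _) lt.
exists (fun i => if i == 0 then m 1 0 else theta2 - m 0 0); split => //=.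
- move=> i; rewrite weight2M /=.
  rewrite -/(m 0 i) -/(m 1 i); case: (ord2P i) => -> /=; first by ring.
  have -> : m 1 1 = theta1 + theta2 - m 0 0 by rewrite tr addrC addKr.
  have -> : m 1 0 * m 0 1 = m 0 0 * m 1 1 - theta1 * theta2 by rewrite dt; ring.
  have -> : m 1 1 = theta1 + theta2 - m 0 0 by rewrite tr addrC addKr.
  by ring.
- rewrite subr_lt0 ltNge; apply/negP => h.
  have : 0 < m 0 1 * m 1 0 by exact: mulr_gt0.
  have -> : m 0 1 * m 1 0 = - ((theta1 - m 0 0) * (theta2 - m 0 0)).
    rewrite (_ : m 0 1 * m 1 0 = m 0 0 * m 1 1 - theta1 * theta2);
      last by rewrite dt; ring.
    by rewrite (_ : m 1 1 = theta1 + theta2 - m 0 0);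
      [ring|rewrite tr addrC addKr].
  by rewrite oppr_gt0 ltNge mulr_ge0 // subr_ge0 // (le_trans h) // ltW.
Qed.

Lemma subst_det_neq0 : 1 < `|theta2| -> m 0 0 * m 1 1 - m 0 1 * m 1 0 != 0.
Proof.
move=> t2; have [_ <-] := trace_det; have [_ lt] := theta12.
rewrite mulf_neq0 // -normr_gt0; last exact: lt_trans t2.
apply: lt_le_trans (ler_norm _); apply: le_lt_trans lt; exact: normr_ge0.
Qed.

End Spectrum.

(** * Windows whose weight is close to a prescribed value *)

Section Windows.
Variables (zeta : substitution 2) (k0 : nat) (x : biseq 2).
Hypothesis hk0 : forall i j, i \in subst_iter zeta k0 j.
Hypothesis xX : subst_space zeta x.
Local Open Scope ring_scope.

Definition zeros (m : int) (n : nat) : nat :=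
  count_mem (0 : 'I_2) (subword x m n).

Lemma zerosSr m n : zeros m n.+1 =
  (zeros m n + (x (m + n%:Z)%R == 0%R :> 'I_2))%N.
Proof. by rewrite /zeros -(addn1 n) subwordD subword1 count_cat /= addn0. Qed.

Lemma zerosSl m n : zeros m n.+1 = ((x m == 0%R :> 'I_2) + zeros (m + 1)%R n)%N.
Proof. by rewrite /zeros -(add1n n) subwordD subword1 count_cat /= addn0. Qed.

Lemma zeros_min : exists lo : nat -> nat,
  (forall m n, (lo n <= zeros m n)%N) /\ (forall n, exists m, zeros m n = lo n).
Proof.
have H n : exists l, (forall m, (l <= zeros m n)%N) /\
  (exists m, zeros m n = l).
  have ex : exists l, `[< exists m, zeros m n = l >] by exists (zeros 0 n);
    apply/asboolP; exists 0.
  case: (ex_minnP ex) => l /asboolP lP lmin; exists l; split => // m.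
  by apply: lmin; apply/asboolP; exists m.
have [lo Hlo] := choice H; exists lo.
by split=> [m|] n; have [] := Hlo n.
Qed.

(* Sliding a window by one step changes the number of zeros by at most one, so
   it takes every intermediate value just before gaining a zero. *)
Lemma zeros_crossing n v m1 m2 : (zeros m1 n <= v)%N -> (v < zeros m2 n)%N ->
  exists m, [/\ x m = 1 :> 'I_2, x (m + n%:Z) = 0 :> 'I_2 & zeros m n = v].
Proof.
move=> h1 h2.
have [r Hr] := language_recurrent hk0 (subst_space_language m2 n xX).
have [j _ Ej] := Hr x m1 xX; rewrite size_subword in Ej.
have ex : exists t, (v < zeros (m1 + t%:Z)%R n)%N by exists j;
  rewrite /zeros Ej.
case: (ex_minnP ex) => [[|t]] vt tmin.
  by move: vt; rewrite addr0 ltnNge h1.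
have tv : (zeros (m1 + t%:Z)%R n <= v)%N.
  by rewrite leqNgt; apply/negP => /tmin; rewrite ltnn.
have := zerosSr (m1 + t%:Z) n; rewrite zerosSl.
have -> : m1 + t%:Z + 1 = m1 + t.+1%:Z by rewrite -addrA -PoszD addn1.
case: (ord2P (x (m1 + t%:Z))) => E0; case: (ord2P (x (m1 + t%:Z + n%:Z))) => E1;
  rewrite E0 E1 /= => E; try lia.
by exists (m1 + t%:Z); split => //; lia.
Qed.

(** [D] is the set of admissible targets: the integers for the shift, all reals for tilings. A word
    of length [n] with [E] zeros more than the minimum [lo n] has weight [g n], which grows by [a]
    or [b] with [n] and so comes within [a + b] of [s]. The pair [(p, q)] found near that population
    differs from it by a bounded amount and stays in the tube. *)
Lemma window_weight (R : realType) (f : 'I_2 -> R) (eps : R) (D : R ->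
  Prop) (B : nat) :
  (forall i, 0 < f i) -> 0 < eps ->
  unbounded_width zeta ->
  (forall s (z : int), D s -> exists p q : int, `|p - z| <= B%:Z /\
     `|p%:~R * f 0 + q%:~R * f 1 - s| < eps) ->
  exists s0, forall s, s0 <= s -> D s -> exists m (n : nat),
   [/\ x m = 1 :> 'I_2, x (m + n%:Z) = 0 :> 'I_2 &
     `|weight f (subword x m n) - s| < eps].
Proof.
move=> f0 eps0 width dens.
set a := f 0; set b := f 1; have a0 : 0 < a by exact: f0.
have b0 : 0 < b by exact: f0.
have [lo [lo_le lo_ex]] := zeros_min.
have loS n : (lo n <= lo n.+1 <= (lo n).+1)%N.
  have [m1 E1] := lo_ex n; have [m2 E2] := lo_ex n.+1.
  have := lo_le m1 n.+1; have := lo_le m2 n; rewrite -E1 -E2 !zerosSr.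
  case: (_ == 0); case: (_ == 0); lia.
have loD n t : (lo n <= lo (n + t)%N <= lo n + t)%N.
  by elim: t => [|t IH]; rewrite ?addn0 ?leqnn // addnS; have := loS (n + t)%N;
    lia.
(* Bound on the error in [q]: the errors of the approximation, of [g n] and of [p], in units of
   [b]. *)
pose B2 := (Num.truncn ((eps + a + b + B%:R * a) / b)).+1.
have hB2 : eps + a + b + B%:R * a < B2%:R * b by rewrite -ltr_pdivrMr //
  truncnS_gt.
(* Passing from [n] to [n' = p + q] moves [lo] by at most [B + B2], and [p] is off by at most [B];
   hence [p] lies strictly between [lo n'] and [lo n' + 2 * E]. *)
pose E := (B + (B + B2)).+1.
have [n0 Hn0] := width (2 * E)%N.
pose N0 := (n0 + B + B2)%N.
pose g n : R := (lo n + E)%:R * a + (n%:R - (lo n + E)%:R) * b.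
have gS n : exists2 c, g n.+1 = g n + c & [/\
  0 < c, Num.min a b <= c & c <= a + b].
  have [e|e] : lo n.+1 = lo n \/ lo n.+1 = (lo n).+1 by have := loS n; lia.
    exists b; first by rewrite /g e -natr1; ring.
    by rewrite b0 lerDr (ltW a0) ge_min lexx orbT.
  exists a; first by rewrite /g e addSn -!natr1; ring.
  by rewrite a0 lerDl (ltW b0) ge_min lexx.
exists (g N0) => s gs Ds.
have ex : exists t, s < g (N0 + t)%N.
  have mab : 0 < Num.min a b by rewrite lt_min a0 b0.
  have gt t : g N0 + t%:R * Num.min a b <= g (N0 + t)%N.
    elim: t => [|t IH]; first by rewrite addn0 mul0r addr0.
    rewrite addnS; have [c -> [_ cm _]] := gS (N0 + t)%N.
    by rewrite -natr1 mulrDl mul1r addrA lerD.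
  exists (Num.truncn ((s - g N0) / Num.min a b)).+1; apply: lt_le_trans (gt _).
  by rewrite -ltrBlDl -ltr_pdivrMr // truncnS_gt.
case: (ex_minnP ex) => [[|t]] st tmin.
  by move: st; rewrite addn0 ltNge gs.
have {}gs : g (N0 + t)%N <= s.
  by rewrite leNgt; apply/negP => /tmin; rewrite ltnn.
rewrite addnS in st; set n := (N0 + t)%N in gs st.
have {}st : s < g n + a + b.
  by have [c ec [_ _ cab]] := gS n; move: st cab; rewrite ec; lra.
have [p [q [pz pq]]] := dens s (lo n + E)%N%:Z Ds.
have qz : `|q - (n%:Z - (lo n + E)%N%:Z)| <= B2%:Z.
  have pz' : `|p%:~R - (lo n + E)%:R| <= B%:R :> R.
    by move: pz; rewrite -(ler_int R) intr_norm rmorphB.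
  rewrite -(ler_int R) intr_norm !rmorphB /=.
  have : `|q%:~R - (n%:R - (lo n + E)%:R)| * b <= B2%:R * b.
    rewrite -[b in leLHS]ger0_norm ?(ltW b0) // -normrM.
    have -> : (q%:~R - (n%:R - (lo n + E)%:R)) * b =
      (p%:~R * a + q%:~R * b - s) + (s - g n) - (p%:~R - (lo n +
        E)%:R) * a :> R.
      by rewrite /g; ring.
    apply: (@le_trans _ _ (eps + (a + b) + B%:R * a)); last by move: hB2; lra.
    rewrite (le_trans (ler_normB _ _)) // lerD //.
      rewrite (le_trans (ler_normD _ _)) // lerD // ?(ltW pq) //.
      by rewrite ger0_norm; move: gs st; lra.
    by rewrite normrM (gtr0_norm a0) ler_wpM2r // ltW.
  by rewrite ler_pM2r.
have nN : (n0 + B + B2 <= n)%N by exact: leq_addr.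
clearbody n.
have [n' En'] : exists n' : nat, n'%:Z = p + q.
  by exists `|(p + q)%R|%N; rewrite gez0_abs //; lia.
have nn' : (n <= n' + (B + B2))%N && (n' <= n + (B + B2))%N by lia.
have lolo : (lo n <= lo n' + (B + B2))%N && (lo n' <= lo n + (B + B2))%N.
  have [h|h] := leqP n n'.
    by have := loD n (n' - n)%N; rewrite subnKC //; lia.
  by have := loD n' (n - n')%N; rewrite subnKC ?(ltnW h) //; lia.
have [p' Ep] : exists p' : nat, p = p'%:Z.
  by exists `|p|%N; rewrite gez0_abs //; rewrite /E in pz *; lia.
have [w [w' [Lw Lw' sw sw' ww']]] :
  exists w w', [/\ language zeta w, language zeta w', size w = n',
    size w' = n' &
    (count_mem 0%R w' + 2 * E <= count_mem 0%R w)%N].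
  by apply: Hn0; lia.
have zw u : language zeta u -> size u = n' ->
  exists m, zeros m n' = count_mem 0%R u.
  move=> Lu su; have [r Hr] := language_recurrent hk0 Lu.
  have [j _ Ej] := Hr x 0 xX; exists (0 + j%:Z).
  by rewrite /zeros -su Ej.
have [m1 E1] := lo_ex n'; have [m2 E2] := zw w Lw sw;
  have [m3 E3] := zw w' Lw' sw'.
have l3 := lo_le m3 n'.
have [|//|m [xm xmn Em]] := @zeros_crossing n' p' m1 m2.
- by rewrite E1; rewrite /E in pz *; lia.
- by rewrite E2; rewrite /E in pz ww' *; lia.
exists m, n'; split => //; rewrite weight2M -/(zeros m n') Em.
have -> : count_mem 1 (subword x m n') = (n' - p')%N.
  by rewrite -Em -[X in (X - _)%N](size_subword x m n') -count_mem01 addKn.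
have p'n : (p' <= n')%N by rewrite -Em /zeros -[X in (_ <= X)%N](size_subword x
  m n'); exact: count_size.
rewrite natrB // ![f _ * _]mulrC; move: pq; rewrite -/a -/b Ep.
have -> : q = n'%:Z - p'%:Z by rewrite En' Ep addrC addKr.
by rewrite rmorphB.
Qed.

(* [W1] is placed in [zeta^k(1)] at one end of a window and [W2] in [zeta^k(0)]
   at the other end. *)
Lemma words_at_distance (R : realType) (t : 'I_2 -> R) (eps : R) (D : R -> Prop)
    (B k : nat) (W1 W2 : seq 'I_2) :
  (forall i, 0 < t i) -> 0 < eps ->
  unbounded_width zeta ->
  (forall s (z : int), D s -> exists p q : int, `|p - z| <= B%:Z /\
     `|p%:~R * weight t (subst_iter zeta k 0) +
       q%:~R * weight t (subst_iter zeta k 1) - s| < eps) ->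
  infix W1 (subst_iter zeta k 1) -> infix W2 (subst_iter zeta k 0) ->
  exists (p1 p2 : seq 'I_2) s0, forall s, s0 <= s ->
    D (s + weight t p1 - weight t p2) -> exists m (n : nat),
    [/\ subword x m (size W1) = W1, subword x (m + n%:Z) (size W2) = W2 &
       `|weight t (subword x m n) - s| < eps].
Proof.
move=> t0 eps0 width dens /infixP[p1 [s1 E1]] /infixP[p2 [s2 E2]].
have f0 i := weight_subst_iter_gt0 zeta k i t0.
have [s0 Hs0] := window_weight f0 eps0 width dens.
(* The window runs from the start of [zeta^k(1)] to the start of [zeta^k(0)], while [W1] and [W2]
   begin after [p1] and [p2]; the target is corrected accordingly. *)
exists p1, p2, (s0 - weight t p1 + weight t p2) => s ss Ds.
have [|m [[|n] [xm xn Hw]]] := Hs0 _ _ Ds; first by move: ss; lra.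
  by move: xn; rewrite addr0 xm.
have L1 : language zeta (subst_pow zeta k (subword x m n.+2)).
  by apply: language_pow; exact: subst_space_language.
set Q := s1 ++ subst_pow zeta k (subword x (m + 1) n) ++ p2.
have EU : subword x m n.+1 = (1 : 'I_2) :: subword x (m + 1) n.
  by rewrite -(add1n n) subwordD subword1 xm.
have EV : subst_pow zeta k (subword x m n.+2) = p1 ++ ((W1 ++ Q) ++ W2) ++ s2.
  rewrite -(addn1 n.+1) subwordD subword1 xn subst_pow_cat EU subst_pow_cons E1.
  by rewrite -[subst_pow _ _ [:: _]]/(subst_iter zeta k 0) E2 /Q -!catA.
have L2 : language zeta ((W1 ++ Q) ++ W2).
  by apply: language_infix L1; rewrite EV; exact: infix_infix.
have [r Hr] := language_recurrent hk0 L2; have [j _ Ej] := Hr x 0 xX.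
have [EQ EW2] := (subword_cat _ _ _ _).1 Ej.
have [EW1 _] := (subword_cat _ _ _ _).1 EQ.
exists (0 + j%:Z), (size (W1 ++ Q)); split => //.
rewrite EQ; move: Hw; rewrite -weight_subst_pow EU subst_pow_cons E1 /Q
  !weight_cat.
by congr (`| _ | < _); lra.
Qed.

End Windows.

(** * Integer combinations with one coefficient nearly prescribed *)

Section Approximation.
Local Open Scope ring_scope.

(** Solutions may be moved by multiples of [(b, -a)]; dividing [s * u - z] by [b] brings [p] close
    to [z]. *)
Lemma bezout_window (a b : nat) : (0 < b)%N -> coprime a b ->
  forall s z : int, exists p q : int,
    `|p - z| <= b%:Z /\ p * a%:Z + q * b%:Z = s.
Proof.
move=> b0 ab s z; have [u [v uv]] := Bezoutz a%:Z b%:Z.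
have {}uv : u * a%:Z + v * b%:Z = 1.
  by rewrite uv /gcdz !absz_nat (eqP ab).
pose k := ((s * u - z) %/ b%:Z)%Z; pose r := ((s * u - z) %% b%:Z)%Z.
have rb : r < b%:Z by apply: ltz_pmod; rewrite ltz_nat.
have r0 : 0 <= r by apply: modz_ge0; rewrite eqz_nat -lt0n.
have E : s * u - z = k * b%:Z + r by exact: divz_eq.
exists (s * u - k * b%:Z), (s * v + k * a%:Z); split.
  have -> : s * u - k * b%:Z - z = r by rewrite addrAC E addrC addKr.
  by rewrite ger0_norm // ltW.
rewrite (_ : _ + _ = s * (u * a%:Z + v * b%:Z)); last by ring.
by rewrite uv mulr1.
Qed.

Variable R : realType.

Lemma fract_itv (x : R) : 0 <= x - (Num.floor x)%:~R < 1.
Proof.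
by have := floor_itv x; rewrite intrD subr_ge0 ltrBlDl.
Qed.

Lemma dirichlet (al eps : R) : 0 < eps -> exists q : nat, exists2 p : int,
  (0 < q)%N & `|q%:R * al - p%:~R| < eps.
Proof.
move=> eps0; pose N := (Num.truncn eps^-1).+1.
have N0 : 0 < N%:R :> R by rewrite ltr0n.
have Neps : N%:R^-1 < eps by rewrite -[ltRHS]invrK ltf_pV2 ?posrE ?invr_gt0 //
  truncnS_gt.
pose fr (i : nat) : R := i%:R * al - (Num.floor (i%:R * al))%:~R.
have fr0 i : 0 <= fr i by have /andP[] := fract_itv (i%:R * al).
have fr1 i : fr i < 1 by have /andP[] := fract_itv (i%:R * al).
have bin i : (Num.truncn (N%:R * fr i) < N)%N.
  by rewrite truncn_lt_nat ?mulr_ge0 // -[ltRHS]mulr1 ltr_pM2l.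
pose h (i : 'I_N.+1) := Ordinal (bin i).
have : ~ injective h by move=> /leq_card; rewrite !card_ord ltnn.
move=> /existsNP[i /existsNP[j /not_implyP[/= hij /eqP ij]]].
wlog lt : i j hij ij / (i < j)%N.
  move=> W; have [lt|lt|E] := ltngtP i j; first exact: (W i j).
    by apply: (W j i) => //; rewrite 1?eq_sym.
  by move: ij; rewrite -val_eqE /= E eqxx.
exists (j - i)%N, (Num.floor (j%:R * al) - Num.floor (i%:R * al));
  first by rewrite subn_gt0.
apply: lt_trans Neps; rewrite natrB ?(ltnW lt) // rmorphB /=.
have -> : (j%:R - i%:R) * al - ((Num.floor (j%:R * al))%:~R - (Num.floor (i%:R
  * al))%:~R)
  = fr j - fr i by rewrite /fr; ring.
have /= E := congr1 val hij.
have h1 k : (Num.truncn (N%:R * fr k))%:R <= N%:R * fr k < (Num.truncn (N%:R *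
  fr k)).+1%:R.
  by apply: truncn_itv; rewrite mulr_ge0.
have := h1 i; have := h1 j; rewrite E => /andP[a1 a2] /andP[a3 a4].
rewrite -natr1 in a2 a4.
rewrite -(ltr_pM2l N0) mulfV ?gt_eqF // -[N%:R in ltLHS]gtr0_norm // -normrM
  mulrBr.
by rewrite ltr_norml; apply/andP; split; lra.
Qed.

(* Multiples of a small nonzero [q al - p] hit every target modulo 1. *)
Lemma irrational_window (a b eps : R) : 0 < a -> 0 < b -> 0 < eps ->
  irrational (b / a) -> exists B : nat, forall (s : R) (z : int), exists p q :
    int,
    `|p - z| <= B%:Z /\ `|p%:~R * a + q%:~R * b - s| < eps.
Proof.
move=> a0 b0 eps0 irr.
pose al := a / b; have alP : a = al * b by rewrite divfK ?gt_eqF.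
have [q0 [p0 q00 small]] := dirichlet al (divr_gt0 eps0 b0).
set eta := q0%:R * al - p0%:~R in small.
have eta0 : eta != 0.
  apply/eqP => /eqP; rewrite subr_eq0 => /eqP E; apply: irr.
  have p0R : al = p0%:~R / q0%:R by rewrite -E mulrC mulKf // pnatr_eq0 -lt0n.
  exists (q0%:R / p0%:~R) => //; rewrite fmorph_div /= rmorph_nat ratr_int.
  by rewrite -invf_div -p0R /al invf_div.
pose J := (Num.truncn `|eta|^-1).+1.
exists (q0 * J)%N => s z.
(* After division by [b] the problem is to bring [p * al] near [s / b] modulo 1. With
   [p = z + q0 * j] it remains to reach [tau] modulo 1 by [j * eta], and [J] steps of size [|eta|]
   cover a unit interval. *)
pose tau := s / b - z%:~R * al.
have [j jJ [y jy]] : exists2 j : nat, (j <= J)%N & exists y :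
  int, `|j%:R * eta + y%:~R - tau| < eps / b.
  have key (e t : R) : 0 < e -> e < eps / b -> (Num.truncn e^-1).+1 = J ->
      exists2 j : nat, (j <= J)%N & exists y :
        int, `|j%:R * e + y%:~R - t| < eps / b.
    move=> e0 es eJ; set u := t - (Num.floor t)%:~R.
    have /andP[u0 u1] : 0 <= u < 1 by exact: fract_itv.
    have /andP[c1 c2] := truncn_itv (divr_ge0 u0 (ltW e0)).
    exists (Num.truncn (u / e)).
      rewrite -eJ -ltnS; apply: ltn_trans (leqnn _).
      rewrite truncn_lt_nat ?divr_ge0 // ?(ltW e0) //.
      apply: le_lt_trans (truncnS_gt _);
        rewrite ler_pdivrMr // mulVf ?gt_eqF // ltW //.
    exists (Num.floor t).
    have -> : (Num.truncn (u / e))%:R * e + (Num.floor t)%:~R - t =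
       (Num.truncn (u / e))%:R * e - u by rewrite /u; ring.
    rewrite ler_pdivlMr // in c1; rewrite ltr_pdivrMr // -natr1 mulrDl mul1r in
      c2.
    by rewrite ltr_norml; apply/andP; split; lra.
  have [ep|en|e0] := ltgtP 0 eta; last by rewrite -e0 eqxx in eta0.
    apply: key => //; first by rewrite -(gtr0_norm ep).
    by rewrite /J (gtr0_norm ep).
  have [|||j jJ [y jy]] := key (- eta) (- tau); rewrite ?oppr_gt0 //.
  - by rewrite -(ltr0_norm en).
  - by rewrite /J (ltr0_norm en).
  exists j => //; exists (- y); rewrite -normrN; move: jy; congr (`| _ | < _).
  by rewrite rmorphN /=; ring.
exists (z + (q0 * j)%:Z), (y - p0 * j%:Z); split.
  by rewrite addrC addKr ger0_norm // lez_nat leq_mul2l jJ orbT.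
rewrite rmorphD rmorphB /= intrM -!pmulrn natrM alP.
have -> : (z%:~R + q0%:R * j%:R) * (al * b) + (y%:~R - p0%:~R * j%:R) * b - s =
  (j%:R * eta + y%:~R - tau) * b.
  have {1}-> : s = s / b * b by rewrite divfK ?gt_eqF.
  by rewrite /tau /eta; ring.
by rewrite normrM (gtr0_norm b0) -ltr_pdivlMr.
Qed.

End Approximation.

(** * Mixing of the substitution shift *)

Section SubstitutionSpace.
Local Open Scope ring_scope.

Lemma open_biseq_window n (O : set (biseq n)) (x : biseq n) : open O -> O x ->
  exists N : nat, forall y : biseq n,
    (forall k : int, `|k| <= N%:Z -> y k = x k) -> O y.
Proof.
move=> oO Ox; apply: contrapT => nN.
have H (N : nat) : exists y : biseq n, (forall k : int, `|k| <= N%:Z ->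
  y k = x k) /\ ~ O y.
  apply: contrapT => H; apply: nN; exists N => y yx; apply: contrapT => nOy.
  by apply: H; exists y.
have [y_ Hy] := choice H.
have : (y_ : nat -> biseq n) @ \oo --> x.
  apply/cvg_sup => k A /= [B [[C oC <-] Cx] BA].
  exists `|k|%N => // N /= kN; apply: BA => /=.
  rewrite (Hy N).1 //; lia.
move=> /(_ O (open_nbhs_nbhs (conj oO Ox)))[N _ /(_ N (leqnn N))].
exact: (Hy N).2.
Qed.

(** Stated for all [M >= N] so that two open sets can share one radius. *)
Lemma open_window n (zeta : substitution n) (U : set (subst_space zeta)) x :
  open U -> U x -> exists N : nat, forall M, (N <= M)%N ->
    forall y : subst_space zeta,
    subword (set_val y) (- M%:Z) (2 * M + 1) =
      subword (set_val x) (- M%:Z) (2 * M + 1) ->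
    U y.
Proof.
move=> [V oV <-] Vx; have [N HN] := open_biseq_window oV Vx.
exists N => M NM y E; apply: HN => k kN.
have := congr1 (fun w => nth (set_val x 0 : 'I_n) w `|(k + M%:Z)%R|%N) E.
rewrite !nth_mkseq; try lia.
by have -> : - M%:Z + `|(k + M%:Z)%R|%N%:Z = k by lia.
Qed.

Lemma near_subword n (x : biseq n) m l :
  \forall y \near x, subword y m l = subword x m l.
Proof.
have FF : Filter (nbhs x) by exact: (@nbhs_filter (biseq n) x).
elim: l => [|l IH]; first exact: (@filterE _ (nbhs x) FF).
have coord k : \forall y \near x, y k = x k.
  exact: (@proj_continuous int (fun=>
    discrete_topology 'I_n) k x _ (discrete_set1 (x k))).
apply: (@filterS2 _ (nbhs x) FF _ _ _ _ IH (coord (m + l%:Z))) => y E1 E2.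
by rewrite -(addn1 l) !subwordD !subword1 E1 E2.
Qed.

Lemma open_cylinder n (zeta : substitution n) m l (w : seq 'I_n) :
  open [set y : subst_space zeta | subword (set_val y) m l = w].
Proof.
exists [set y : biseq n | subword y m l = w] => //.
rewrite openE => x /= xw; rewrite /interior /=.
have FF : Filter (nbhs x) by exact: (@nbhs_filter (biseq n) x).
by apply: (@filterS _ (nbhs x) FF _ _ _ (near_subword x m l)) => y /= ->.
Qed.

Lemma gcd_of_mixing (zeta : substitution 2) (n : nat) :
  primitive zeta -> aperiodic zeta ->
    topologically_mixing (@subst_shift 2 zeta) ->
  gcdn (size (subst_iter zeta n 0)) (size (subst_iter zeta n 1)) = 1%N.
Proof.
move=> /primitive_mem[k0 hk0] aper mix; set d := gcdn _ _.
have d0 : (0 < d)%N by rewrite gcdn_gt0 size_subst_iter_gt0.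
apply/eqP; rewrite eqn_leq d0 andbT leqNgt; apply/negP => d1.
have hd i : (d %| size (subst_iter zeta n i))%N.
  by case: (ord2P i) => ->; rewrite ?dvdn_gcdl ?dvdn_gcdr.
have [w Lw sync] := synchronizing_word hk0 hd d1 aper.
have [x xX] := aperiodic_nonempty aper.
have [r Hr] := language_recurrent hk0 Lw; have [j _ Ej] := Hr x 0 xX.
pose U := [set y : subst_space zeta | subword (set_val y) 0 (size w) = w].
have oU : open U by exact: open_cylinder.
have U0 : U !=set0.
  exists (exist _ (Defs.shift j%:Z x) (mem_set (shift_subst_space j%:Z xX))).
  by rewrite /U /= subword_shift Ej.
have [g g0 Hg] := mix U U oU oU U0 U0.
(* A time beyond [g] that is 1 modulo [d]. *)
pose h : nat := (`|g| * d + 1)%N.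
have gh : g <= `|h%:Z| by rewrite /h; nia.
have [y [Uy [z Uz E]]] := Hg h%:Z gh.
have zX : subst_space zeta (set_val z) by exact: set_mem (valP z).
have Uy' : subword (set_val z) (0 + h%:Z) (size w) = w.
  by rewrite -subword_shift; move: Uy; rewrite /U /= -E.
have := recurrence_dvdn hk0 Lw sync zX Uz Uy'.
by rewrite dvdn_addr ?dvdn_mull // dvdn1 => /eqP dE; rewrite dE in d1.
Qed.

Lemma mixing_of_gcd (R : realType) (zeta : substitution 2) (theta1 theta2 : R) :
  primitive zeta -> subst_space zeta !=set0 ->
  perron_frobenius_pair (subst_mx zeta) theta1 theta2 -> 1 < `|theta2| ->
  (forall n : nat, (1 <= n)%N ->
     gcdn (size (subst_iter zeta n 0)) (size (subst_iter zeta n 1)) = 1%N) ->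
  topologically_mixing (@subst_shift 2 zeta).
Proof.
move=> /primitive_mem[k0 hk0] [x xX] theta12 theta2_gt1 hgcd U V oU oV [u Uu]
  [v Vv].
have [phi [eig phi0 phi1]] := second_eigenvector hk0 theta12.
have width := count_width hk0 theta2_gt1 eig phi0 phi1.
have [NU HU] := open_window oU Uu; have [NV HV] := open_window oV Vv.
pose N := maxn NU NV.
set W1 := subword (set_val u) (- N%:Z) (2 * N + 1) in HU.
set W2 := subword (set_val v) (- N%:Z) (2 * N + 1) in HV.
have s1 : size W1 = (2 * N + 1)%N by exact: size_subword.
have s2 : size W2 = (2 * N + 1)%N by exact: size_subword.
have L1 : language zeta W1 by apply: subst_space_language;
  exact: set_mem (valP u).
have L2 : language zeta W2 by apply: subst_space_language;
  exact: set_mem (valP v).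
have dist V1 V2 : language zeta V1 -> language zeta V2 ->
    exists n0 : nat, forall n : nat, (n0 <= n)%N -> exists m,
      subword x m (size V1) = V1 /\ subword x (m + n%:Z) (size V2) = V2.
  move=> LV1 LV2.
  have [k1 H1] := language_infix_iter hk0 LV1;
    have [k2 H2] := language_infix_iter hk0 LV2.
  (* The successor puts [k] in the range [k >= 1] of the coprimality hypothesis. *)
  pose k := (maxn k1 k2).+1.
  have wt1 w : weight (fun=> 1) w = (size w)%:R :> R.
    elim: w => [|i w IH]; first by rewrite weight_nil.
    by rewrite weight_cons IH /= -natr1 addrC.
  pose D (s : R) := exists z : int, s = z%:~R.
  have dens s (z : int) : D s -> exists p q :
    int, `|p - z| <= (size (subst_iter zeta k 1))%:Z /\
     `|p%:~R * weight (fun=> 1) (subst_iter zeta k 0) +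
       q%:~R * weight (fun=> 1) (subst_iter zeta k 1) - s| < 1.
    have cop : coprime (size (subst_iter zeta k 0)) (size (subst_iter zeta k
      1)).
      by apply/eqP; exact: hgcd.
    move=> [y ->]; have [p [q [pz pq]]] :=
      bezout_window (size_subst_iter_gt0 zeta k 1) cop y z.
    exists p, q; split => //; rewrite !wt1.
    by rewrite -[X in X - _](_ : y%:~R =
      _) ?subrr ?normr0 // -pq rmorphD !rmorphM.
  have k1k : (k1 <= k)%N by rewrite ltnW // ltnS leq_maxl.
  have k2k : (k2 <= k)%N by rewrite ltnW // ltnS leq_maxr.
  have [p1 [p2 [s0 Hs0]]] := words_at_distance hk0 xX (fun=>
    ltr01) ltr01 width dens
      (H1 k 1 k1k) (H2 k 0 k2k).
  exists (Num.truncn s0).+1 => l sl.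
  have sl' : s0 <= l%:R by apply: le_trans (ltW (truncnS_gt s0)) _;
    rewrite ler_nat.
  have [|m [l' [m1 m2 ll']]] := Hs0 _ sl'.
    by exists (l%:Z + (size p1)%:Z - (size p2)%:Z);
      rewrite !wt1 rmorphB rmorphD.
  (* Tolerance 1 between integers means equality. *)
  exists m; split => //; suff -> : l = l' by [].
  move: ll'; rewrite wt1 size_subword -[_ - _](_ : (l'%:Z - l%:Z)%:~R = _);
    last first.
    by rewrite rmorphB.
  rewrite -intr_norm (ltr_int R _ 1); lia.
have [n1 D1] := dist W1 W2 L1 L2; have [n2 D2] := dist W2 W1 L2 L1.
exists (maxn n1 n2).+1%:Z => // g gr.
(* Both points are taken in the orbit of [x]; the sign of [g] decides which of the two words comes
   first. *)
suff [a [b [Ea Eb ab]]] : exists a b : int, [/\ subword x a (size W1) = W1,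
    subword x b (size W2) = W2 & a - b = g].
  pose z c : subst_space zeta := exist _ (Defs.shift c x) (mem_set
    (shift_subst_space c xX)).
  have Ez : subst_shift g (z (b + N%:Z)) = z (a + N%:Z).
    by apply/val_inj/funext => c /=; rewrite /Defs.shift; congr (x _);
      rewrite -ab; ring.
  exists (z (a + N%:Z)); split; last first.
    exists (z (b + N%:Z)) => //; apply: (HV N); first exact: leq_maxr.
    rewrite -[RHS]/W2 -[in RHS]Eb s2.
    by rewrite -[LHS]/(subword (Defs.shift _ x) _ _) subword_shift addrCA addNr
      addr0.
  apply: (HU N); first exact: leq_maxl.
  rewrite -[RHS]/W1 -[in RHS]Ea s1.
  by rewrite -[LHS]/(subword (Defs.shift _ x) _ _) subword_shift addrCA addNr
    addr0.
have [g0|g0] := leP 0 g.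
  have [|m [E2 E1]] := D2 `|g|%N; first by lia.
  by exists (m + `|g|%N%:Z), m; split => //; rewrite addrC addKr gez0_abs.
have [|m [E1 E2]] := D1 `|g|%N; first by lia.
by exists m, (m + `|g|%N%:Z); split => //; rewrite opprD addNKr; lia.
Qed.

End SubstitutionSpace.

(** * Tiles laid side by side *)

Section Placement.
Local Open Scope ring_scope.
Variables (R : realType) (n : nat) (t : 'I_n -> {posnum R}).
Implicit Types (w u v : seq 'I_n) (S P : set (R * 'I_n)) (p q r :
  R * 'I_n) (a : R).

Definition len (i : 'I_n) : R := (t i)%:num.

Lemma len_gt0 i : 0 < len i. Proof. by rewrite /len. Qed.

Lemma weight_len_ge0 w : 0 <= weight len w.
Proof. by apply: sumr_ge0 => i _; exact: ltW (len_gt0 i). Qed.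

Lemma len_lb : exists2 tau : R, 0 < tau & forall i, tau <= len i.
Proof.
exists (\big[Num.min/1]_i len i).
  by apply: (big_ind (fun z => 0 < z)) => // [x y x0 y0|i _];
    [rewrite lt_min x0|exact: len_gt0].
by move=> i; exact: bigmin_le.
Qed.

Lemma weight_len_ge (tau : R) w : (forall i, tau <= len i) ->
  (size w)%:R * tau <= weight len w.
Proof.
move=> H; elim: w => [|i w IH]; first by rewrite mul0r weight_nil.
by rewrite weight_cons /= -natr1 mulrDl mul1r addrC lerD.
Qed.

Fixpoint place a w : seq (R * 'I_n) :=
  if w is i :: w' then (a, i) :: place (a + len i) w' else [::].

Lemma place_cat a u v : place a (u ++ v) =
  place a u ++ place (a + weight len u) v.
Proof.
elim: u a => [|i u IH] a; first by rewrite weight_nil addr0.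
by rewrite /= IH weight_cons addrA.
Qed.

Lemma place_snd a w : map snd (place a w) = w.
Proof. by elim: w a => //= i w IH a; rewrite IH. Qed.

Lemma place_sorted a w : sorted (fun p q => p.1 < q.1) (place a w).
Proof.
case: w => // i w; elim: w a i => //= j w IH a i.
by rewrite ltrDl len_gt0 IH.
Qed.

Lemma mem_place a w p : p \in place a w ->
  exists u v, w = u ++ p.2 :: v /\ p.1 = a + weight len u.
Proof.
elim: w a => //= i w IH a; rewrite inE => /orP[/eqP->|/IH[u [v [-> ->]]]].
  by exists [::], w; rewrite weight_nil addr0.
by exists (i :: u), v; rewrite weight_cons addrA.
Qed.

Lemma mem_place_bounds a w p : p \in place a w ->
  a <= p.1 /\ p.1 + len p.2 <= a + weight len w.
Proof.
move=> /mem_place[u [v [-> ->]]]; rewrite weight_cat weight_cons.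
by have := weight_len_ge0 u; have := weight_len_ge0 v; split; lra.
Qed.

Lemma place_cover_ltr a w x : a <= x -> x < a + weight len w ->
  exists2 p, p \in place a w & p.1 <= x < p.1 + len p.2.
Proof.
elim: w a => [|i w IH] a ax; first by rewrite weight_nil addr0 ltNge ax.
rewrite weight_cons addrA => xw; have [h|h] := ltP x (a + len i).
  by exists (a, i); rewrite ?mem_head //= ax h.
by have [p pw px] := IH _ h xw; exists p => //; rewrite inE pw orbT.
Qed.

Lemma place_cover a w : w != [::] ->
  \bigcup_(p in [set` place a w]) tile_support t p = [set` `[a,
    a + weight len w]].
Proof.
move=> w0; apply/seteqP; split => x /=.
  move=> [p /= /mem_place_bounds[h1 h2]]; rewrite /tile_support /= !in_itv /=.
  by move=> /andP[h3 h4]; rewrite (le_trans h1 h3) (le_trans h4 h2).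
rewrite in_itv /= => /andP[h1]; rewrite le_eqVlt => /orP[/eqP->|h2].
  case/lastP: w w0 => // w i _; rewrite -cats1.
  exists (a + weight len w, i); first by rewrite /= place_cat mem_cat mem_head
    orbT.
  rewrite /tile_support /= in_itv /= weight_cat weight1 addrA lexx andbT.
  by rewrite lerDl; exact/ltW/len_gt0.
have [p pw /andP[h3 h4]] := place_cover_ltr h1 h2.
by exists p => //; rewrite /tile_support /= in_itv /= h3 ltW.
Qed.

Lemma translate_place y a w : translate y [set` place a w] =
  [set` place (a - y) w].
Proof.
apply/seteqP; split => p /=.
  move=> [q /= qw <-]; elim: w a qw => //= i w IH a; rewrite !inE.
  by case/orP => [/eqP->|/IH]; rewrite ?eqxx //= addrAC => ->; rewrite orbT.
move=> pw; exists (p.1 + y, p.2); last by rewrite /= addrK; case: (p).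
elim: w a pw => //= i w IH a; rewrite !inE => /orP[/eqP->|].
  by rewrite /= subrK eqxx.
by rewrite addrAC => /IH ->; rewrite orbT.
Qed.

Lemma place_patch a w S : tiles t setT S -> [set` place a w] `<=` S ->
  w != [::] ->
  Defs.patch t [set` place a w].
Proof.
move=> tS wS w0; exists a, (a + weight len w); split.
  by rewrite ltrDl; apply: weight_gt0 => //; exact: len_gt0.
split; first exact: place_cover.
exact: sub_trivIset tS.2.
Qed.

Lemma place_allowed (zeta : substitution n) a w S : tiling_set zeta t S ->
  [set` place a w] `<=` S -> w != [::] -> allowed zeta w.
Proof.
move=> [tS H] wS w0; apply: (H [set` place a w]) => //;
  first exact: place_patch tS wS w0.
by exists (place a w); rewrite place_snd; split => //; exact: place_sorted.
Qed.

Lemma tiles_meet S p q : tiles t setT S -> S p -> S q ->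
  p.1 < q.1 + len q.2 -> q.1 < p.1 + len p.2 -> p = q.
Proof.
move=> tS Sp Sq pq qp.
pose lo := Num.max p.1 q.1; pose hi := Num.min (p.1 + len p.2) (q.1 + len q.2).
have lohi : lo < hi by rewrite lt_min !gt_max pq qp !ltrDl !len_gt0.
have [x1 x2] := midf_lt lohi.
move: x1 x2; rewrite gt_max lt_min => /andP[a1 a2] /andP[a3 a4].
by apply: (tiles_overlap tS Sp Sq (x := (lo + hi) / 2));
  [rewrite a1 a3|rewrite a2 a4].
Qed.

(** The tile [r] covering the point [tau / 2] beyond the end [b] starts at most [tau / 2] after [b].
    Were there a gap, a tile covering its midpoint would start after [b] too and, being at least
    [tau] long, overlap [r]. *)
Lemma tiles_next S p : tiles t setT S -> S p ->
  exists2 q, S q & q.1 = p.1 + len p.2.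
Proof.
move=> tS Sp; have [tau tau0 Htau] := len_lb.
have cover y : exists2 r, S r & r.1 <= y <= r.1 + len r.2.
  have : [set: R] y by []. 
  by rewrite -tS.1 => -[r Sr]; rewrite /tile_support /= in_itv /=; exists r.
set b := p.1 + len p.2.
have right r y : S r -> b < y -> r.1 <= y <= r.1 + len r.2 -> b <= r.1.
  move=> Sr yb /andP[h1 h2]; rewrite leNgt; apply/negP => rb.
  have E : p = r by apply: (tiles_meet tS Sp Sr) => //; have := len_gt0 p.2;
    rewrite /b in yb rb *; lra.
  by move: h2; rewrite -E -/b; lra.
have [r Sr ry] := cover (b + tau / 2).
have br : b <= r.1 by apply: right Sr _ ry; lra.
move: br; rewrite le_eqVlt => /orP[/eqP br|br]; first by exists r.
have [r' Sr' ry'] := cover ((b + r.1) / 2).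
have br' : b <= r'.1 by apply: right Sr' _ ry'; lra.
have := Htau r'.2; move: ry ry' => /andP[a1 a2] /andP[a3 a4] a5.
have E : r = r' by apply: (tiles_meet tS Sr Sr'); have := len_gt0 r.2; lra.
by move: a3; rewrite -E; lra.
Qed.

Lemma tiles_chain S p : tiles t setT S -> S p -> forall N : nat,
  exists2 w, size w = N.+1 & [set` place p.1 w] `<=` S.
Proof.
move=> tS Sp N; suff [w <- ww] :
  exists2 w, size w = N & [set` place p.1 (p.2 :: w)] `<=` S.
  by exists (p.2 :: w).
elim: N p Sp => [|N IH] p Sp.
  by exists [::] => // q; rewrite /= inE => /eqP->; case: (p) Sp.
have [q Sq qp] := tiles_next tS Sp; have [w sw wS] := IH _ Sq.
exists (q.2 :: w); first by rewrite /= sw.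
move=> r; rewrite [X in X -> _]/= inE => /orP[/eqP->|]; first by case: (p) Sp.
by rewrite -qp; exact: wS.
Qed.

Lemma mem_place_tiles S p w q : tiles t setT S -> [set` place p.1 w] `<=` S ->
  S q ->
  p.1 <= q.1 -> q.1 < p.1 + weight len w -> q \in place p.1 w.
Proof.
move=> tS wS Sq pq qw; have [r rw /andP[h1 h2]] := place_cover_ltr pq qw.
suff -> : q = r by [].
by apply: (tiles_meet tS Sq (wS _ rw)) => //; have := len_gt0 q.2; lra.
Qed.

Lemma tiles_chain_to S p (e : R) : tiles t setT S -> S p ->
  exists w, [/\ w != [::], [set` place p.1 w] `<=` S & e < p.1 + weight len w].
Proof.
move=> tS Sp; have [tau tau0 Htau] := len_lb.
have [w sw wS] := tiles_chain tS Sp (Num.truncn ((e - p.1) / tau)).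
exists w; split => //; first by case: w sw {wS}.
rewrite -ltrBlDl; apply: lt_le_trans (weight_len_ge w Htau).
by rewrite sw -ltr_pdivrMr // truncnS_gt.
Qed.

Lemma patch_place S P : tiles t setT S -> Defs.patch t P -> P `<=` S ->
  exists a w, [/\ w != [::], [set` place a w] `<=` S & P `<=` [set` place a w]].
Proof.
move=> tS /patch_ends[p [q [Pp Pq pq H]]] PS.
have [w [w0 wS ew]] := tiles_chain_to (q.1 + len q.2) tS (PS _ Pp).
exists p.1, w; split => // r Pr; have [h1 h2] := H _ Pr.
apply: (mem_place_tiles tS wS (PS _ Pr)) => //.
by apply: le_lt_trans ew; apply: le_trans h2; rewrite lerDl; exact/ltW/len_gt0.
Qed.

End Placement.

(** * The tiling carried by a two-sided sequence *)

Section SequenceTiling.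
Local Open Scope ring_scope.
Variables (R : realType) (n : nat) (t : 'I_n -> {posnum R}) (x : biseq n).
Local Notation len := (len t).

(** Left end of tile [m], with tile 0 starting at the origin; [Negz k] is [-(k+1)], whence the
    length [k.+1]. *)
Definition pos (m : int) : R := match m with
  | Posz k => weight len (subword x 0 k)
  | Negz k => - weight len (subword x (Negz k) k.+1)
  end.

Definition seq_tiling : set (R * 'I_n) := [set p | exists m, p = (pos m, x m)].

Lemma posS m : pos (m + 1) = pos m + len (x m).
Proof.
case: m => k.
  by rewrite -PoszD /= subwordD subword1 weight_cat weight1 add0r.
have E : subword x (Negz k) k.+1 = (x (Negz k) :
  'I_n) :: subword x (Negz k + 1) k.
  by rewrite -(add1n k) subwordD subword1.
rewrite [in RHS]/pos E weight_cons opprD addrAC addNr add0r.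
case: k E => [|k] E; first by rewrite /subword /= weight_nil oppr0.
by have -> : Negz k.+1 + 1 = Negz k by lia.
Qed.

Lemma posD m k : pos (m + k%:Z) = pos m + weight len (subword x m k).
Proof.
elim: k => [|k IH]; first by rewrite addr0 weight_nil addr0.
rewrite -(addn1 k) PoszD addrA posS IH subwordD subword1 weight_cat weight1.
by rewrite addrA.
Qed.

Lemma pos_le m m' : m <= m' -> pos m <= pos m'.
Proof.
move=> mm'; have -> : m' = m + `|m' - m|%N%:Z by lia.
by rewrite posD lerDl weight_len_ge0.
Qed.

Lemma pos_lt m m' : m < m' -> pos m < pos m'.
Proof.
move=> mm'; apply: lt_le_trans (pos_le (m := m + 1) _); last by lia.
by rewrite posS ltrDl len_gt0.
Qed.

Lemma place_subword m l :
  place t (pos m) (subword x m l) = [seq (pos (m + i%:Z), x (m + i%:Z) :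
    'I_n) | i <- iota 0 l].
Proof.
elim: l => // l IH.
rewrite -(addn1 l) iotaD map_cat -IH subwordD subword1 place_cat /= posD add0n.
by [].
Qed.

Lemma mem_place_subword m l p : p \in place t (pos m) (subword x m l) <->
  exists j, [/\ m <= j, j < m + l%:Z & p = (pos j, x j)].
Proof.
rewrite place_subword; split => [/mapP[i]|[j [mj jl ->]]].
  by rewrite mem_iota => /andP[_ il] ->; exists (m + i%:Z); split => //; lia.
apply/mapP; exists `|j - m|%N; first by rewrite mem_iota; lia.
by have -> : m + `|j - m|%N = j by lia.
Qed.

Lemma place_seq_tiling m l : [set` place t (pos m) (subword x m l)] `<=`
  seq_tiling.
Proof. by move=> p /= /mem_place_subword[j [_ _ ->]]; exists j. Qed.

Lemma seq_tiling_tiles : tiles t setT seq_tiling.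
Proof.
split.
  apply/seteqP; split => // y _.
  have [tau tau0 Htau] := len_lb t.
  pose N := (Num.truncn (`|y| / tau)).+1.
  have yN : `|y| < N%:R * tau by rewrite -ltr_pdivrMr // truncnS_gt.
  have h1 : pos (- N%:Z) <= - (N%:R * tau).
    have := posD (- N%:Z) N; rewrite addNr /= weight_nil => /eqP.
    have := weight_len_ge (subword x (- N%:Z) N) Htau; rewrite size_subword.
    by move=> h /eqP; lra.
  have h2 : N%:R * tau <= pos (- N%:Z) + weight len (subword x (- N%:Z) (N +
    N)).
    rewrite -posD PoszD addKr /=.
    by have := weight_len_ge (subword x 0 N) Htau; rewrite size_subword.
  have [||p pw /andP[p1 p2]] := @place_cover_ltr _ _ t (pos (- N%:Z)) (subword
    x (- N%:Z) (N + N)) y.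
  - by apply: le_trans h1 _; rewrite lerNl (le_trans _ (ltW yN)) // -normrN
    ler_norm.
  - by apply: lt_le_trans h2; apply: le_lt_trans (ler_norm _) yN.
  exists p; first exact: place_seq_tiling pw.
  by rewrite /tile_support /= in_itv /= p1 ltW.
have dis m m' y : m < m' -> tile_interior t (pos m, x m : 'I_n) y ->
    tile_interior t (pos m', x m' : 'I_n) y -> False.
  move=> mm'; rewrite /tile_interior /= !in_itv /= => /andP[_ h1] /andP[h2 _].
  have mm1 : m + 1 <= m' by lia.
  have := pos_le mm1; rewrite posS -/(len _) in h1 *; lra.
move=> _ _ [m ->] [m' ->] [y [h1 h2]].
have [mm'|mm'|-> //] := ltgtP m m'.
  by case: (dis _ _ _ mm' h1 h2).
by case: (dis _ _ _ mm' h2 h1).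
Qed.

Lemma path_bounds (p q : R * 'I_n) s : path (fun p q => p.1 < q.1) p s ->
  q \in p :: s -> p.1 <= q.1 <= (last p s).1.
Proof.
elim: s p q => [|r s IH] p q /=; first by rewrite inE => _ /eqP->; rewrite lexx.
move=> /andP[pr rs]; rewrite inE => /orP[/eqP->|/(IH _ _ rs)/andP[h ->]].
  have /andP[_ h] := IH _ _ rs (mem_head _ _).
  by rewrite lexx (le_trans (ltW pr) h).
by rewrite (le_trans (ltW pr) h).
Qed.

(** A patch contains every tile between its first and its last one: the midpoint of such a tile lies
    in the interval covered and in no other tile. Sorted lists with the same members being equal,
    the patch is a consecutive stretch. *)
Lemma seq_tiling_set (zeta : substitution n) : subst_space zeta x ->
  tiling_set zeta t seq_tiling.
Proof.
move=> xX; split; first exact: seq_tiling_tiles.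
move=> P w PS [a [b [ab [cov _]]]] [s [ss EP ->]].
have sP p : p \in s <-> P p by rewrite EP.
have s0 : s != [::].
  apply/eqP => E; have : [set` `[a, b]] a by rewrite /= in_itv /= lexx ltW.
  by rewrite -cov => -[p /sP]; rewrite E.
case: s s0 ss EP sP => // p s _ ss EP sP.
have tr : transitive (fun p q : R * 'I_n => p.1 < q.1) by move=> q1 q2 q3;
  exact: lt_trans.
have [m Em] : seq_tiling p by apply/PS/sP; rewrite mem_head.
have [m' Em'] : seq_tiling (last p s) by apply/PS/sP; rewrite mem_last.
have bounds q : q \in p :: s -> p.1 <= q.1 <= (last p s).1.
  exact: path_bounds ss.
have sup q y : P q -> tile_support t q y -> a <= y <= b.
  move=> Pq qy; have : [set` `[a, b]] y by rewrite -cov; exists q.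
  by rewrite /= in_itv.
have le_pos j j' : (pos j <= pos j') = (j <= j').
  by have [h|h] := leP j j'; [rewrite pos_le|rewrite leNgt pos_lt].
suff -> : p :: s = place t (pos m) (subword x m `|(m' + 1 - m)%R|%N).
  by rewrite place_snd; exists x => //; exists m; rewrite size_subword.
have mm' : m <= m'.
  by rewrite -le_pos; have := bounds p (mem_head _ _); rewrite Em' Em /=;
    case/andP.
have irr : irreflexive (fun p q : R * 'I_n => p.1 < q.1) by move=> q;
  rewrite ltxx.
apply: (irr_sorted_eq tr irr ss (place_sorted _ _ _)).
move=> q; apply/idP/idP => qs.
  apply/mem_place_subword; have [j Ej] := PS _ ((sP q).1 qs).
  by have := bounds q qs; rewrite Em' Em Ej /= !le_pos => /andP[? ?]; exists j;
    split => //; lia.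
move: qs => /mem_place_subword[j [mj jm' ->]].
pose c := pos j + len (x j) / 2.
have lj := len_gt0 t (x j).
have [c1 c2] : pos j < c /\ c < pos (j + 1) by rewrite posS /c; split; lra.
have : [set` `[a, b]] c.
  have tile_ends r (Pr : P r) : a <= r.1 /\ r.1 + len r.2 <= b.
    have lr := len_gt0 t r.2.
    have /andP[a1 _] : a <= r.1 <= b.
      by apply: (sup r) => //; rewrite /tile_support /= in_itv /= lexx lerDl
        ltW.
    have /andP[_ a2] : a <= r.1 + len r.2 <= b.
      by apply: (sup r) => //; rewrite /tile_support /= in_itv /= lexx lerDl
        ltW.
    by [].
  have [a1 _] := tile_ends _ ((sP p).1 (mem_head _ _)).
  have [_ a2] := tile_ends _ ((sP (last p s)).1 (mem_last _ _)).
  rewrite Em /= in a1; rewrite Em' /= -posS in a2.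
  have h1 : pos m <= pos j by rewrite le_pos.
  have h2 : pos (j + 1) <= pos (m' + 1) by rewrite le_pos; lia.
  by rewrite /= in_itv /=; apply/andP; split; lra.
rewrite -cov => -[r Pr]; have [j' Ej'] := PS _ Pr; rewrite Ej' in Pr *.
rewrite /tile_support /= in_itv /= -/(len _) -posS => /andP[r1 r2].
have j'j : ~~ (j + 1 <= j') by rewrite -le_pos -ltNge (le_lt_trans r1).
have jj' : ~~ (j' + 1 <= j) by rewrite -le_pos -ltNge (lt_le_trans c1).
have <- : j' = j by lia.
exact/sP.
Qed.

End SequenceTiling.

(** * Neighbourhoods in the tiling space described by words *)

Section TilingSpace.
Local Open Scope ring_scope.
Variables (R : realType) (n : nat) (zeta : substitution n) (t : 'I_n ->
  {posnum R}).

(** The patch is enlarged to a run of consecutive tiles, so that a word describes it;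
    [delta = e - |y|] is the room left for translations. *)
Lemma open_tiling_place (U : set (tiling_space zeta t)) S : open U -> U S ->
  exists a w (delta : R), [/\ allowed zeta w, 0 < delta &
    forall S' : tiling_space zeta t, (exists2 z, `|z| < delta &
      [set` place t (a + z) w] `<=` set_val S') -> U S'].
Proof.
rewrite tiling_openE => -[D Dsub <-] [[P e] DPe [y /andP[/= y1 y2] yP]].
have [/= pP e0] := Dsub _ DPe.
have tS := set_mem (valP S).
have [a [w [w0 wS Pw]]] := patch_place tS.1 (patch_translate y pP) yP.
exists a, w, (e - `|y|); split; first exact: place_allowed tS wS w0.
  by rewrite subr_gt0 ltr_norml y1 y2.
move=> S' [z zd zS']; exists (P, e) => //; exists (y - z) => /=.
  by rewrite -ltr_norml (le_lt_trans (ler_normB _ _)) // -ltrBrDl.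
rewrite -translateD; apply: subset_trans zS'.
by rewrite -[in a + z](opprK z) -translate_place; apply: image_subset.
Qed.

Lemma open_tiling_base (b : base_index R n) : tiling_index t b ->
  open (@tiling_base R n zeta t b).
Proof.
move=> bt; rewrite tiling_openE; exists [set b]; first by move=> _ ->.
by rewrite bigcup_set1.
Qed.

Definition translate_tiling (g : R) S (HS : tiling_set zeta t S) :
  tiling_space zeta t :=
  exist _ (Defs.translate g S) (mem_set (translate_tiling_set g HS)).

Lemma tiling_shift_translate g c S (HS : tiling_set zeta t S) :
  tiling_shift g (translate_tiling c HS) = translate_tiling (c + g) HS.
Proof. by apply/val_inj; rewrite /= translateD. Qed.

Lemma place_translate_tiling (x : biseq n) (xX : subst_space zeta x) c m w :
  subword x m (size w) = w ->
  [set` place t (pos t x m - c) w] `<=`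
  set_val (translate_tiling c (seq_tiling_set t xX)).
Proof.
move=> mw; rewrite -translate_place -{1}mw; apply: image_subset.
exact: place_seq_tiling.
Qed.

End TilingSpace.

(** * Mixing of the tiling flow *)

Section TwoTiles.
Local Open Scope ring_scope.
Variables (R : realType) (zeta : substitution 2) (t : 'I_2 -> {posnum R}).

Lemma irrational_of_mixing : subst_space zeta !=set0 ->
  topologically_mixing (@tiling_shift R 2 zeta t) ->
  irrational ((t 1)%:num / (t 0)%:num).
Proof.
move=> [x xX] mix [c _ cE].
have t0 : 0 < (t 0)%:num by [].
have t1 : 0 < (t 1)%:num by [].
(* With [c] the rational ratio, both tile lengths are integer multiples of [s]. *)
pose s := (t 0)%:num / (denq c)%:~R.
have d0 : 0 < (denq c)%:~R :> R by rewrite ltr0z denq_gt0.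
have s0 : 0 < s by exact: divr_gt0.
have lenZ i : exists k : int, len t i = k%:~R * s.
  case: (ord2P i) => ->; first by exists (denq c); rewrite mulrC divfK ?gt_eqF.
  exists (numq c); rewrite /len -[LHS](divfK (lt0r_neq0 t0)) -cE /ratr /s.
  by rewrite mulrAC mulrA.
have weightZ w : exists k : int, weight (len t) w = k%:~R * s.
  elim: w => [|i w [k Ek]]; first by exists 0; rewrite weight_nil mul0r.
  by have [l El] := lenZ i; exists (l + k);
    rewrite weight_cons Ek El rmorphD mulrDl.
pose i0 : 'I_2 := x 0.
have bt : tiling_index t ([set (0, i0)], s / 4).
  by split; [exact: tile1_patch|rewrite /= divr_gt0].
pose U := @tiling_base R 2 zeta t ([set (0, i0)], s / 4).
have oU : open U by exact: open_tiling_base.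
have U0 : U !=set0.
  exists (exist _ (seq_tiling t x) (mem_set (seq_tiling_set t xX))).
  exists 0; first by rewrite /= oppr_lt0 divr_gt0.
  rewrite translate0 => _ -> /=; exists 0.
  by rewrite /pos /subword /= weight_nil.
have [r r0 Hr] := mix U U oU oU U0 U0.
pose M := (Num.truncn (r / s)).+1.
have rM : r < M%:R * s by rewrite -ltr_pdivrMr // truncnS_gt.
(* Two tile positions known up to [s / 4] change the distance [g] by less than [s / 2]. It then lies
   strictly between [M * s] and [(M + 1) * s], although it must be a multiple of [s]. *)
pose g := s / 2 + M%:R * s.
have [|S [[y /andP[/= y1 y2] Sy] [S' [y' /andP[/= y'1 y'2] Sy'] E]]] := Hr g.
  by rewrite ger0_norm /g; lra.
have tS := (set_mem (valP S)).1.
have Sp : set_val S (0 - y, i0) by apply: Sy; exists (0, i0).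
have Sq : set_val S (0 - y' - g, i0).
  by rewrite -E; exists (0 - y', i0) => //; apply: Sy'; exists (0, i0).
have [w [w0 wS pw]] := tiles_chain_to (0 - y) tS Sq.
have M1 : s <= M%:R * s by rewrite ler_peMl ?(ltW s0) ?ler1n.
have := mem_place_tiles tS wS Sp; rewrite /= => /(_ _ pw) pin.
have {pin} : (0 - y, i0) \in place t (0 - y' - g) w by apply: pin; rewrite /g;
  lra.
move=> /mem_place[u [v [_ /= Eu]]]; have [k Ek] := weightZ u.
have kE : k%:~R * s = s / 2 + M%:R * s + (y' - y).
  by rewrite -Ek; move: Eu; rewrite /g; lra.
have k1 : (M%:Z < k).
  rewrite -(ltr_int R) -(ltr_pM2r s0) kE /=; lra.
have k2 : (k < M%:Z + 1).
  rewrite -(ltr_int R) -(ltr_pM2r s0) kE rmorphD /= mulrDl mul1r; lra.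
by move: k2; rewrite ltzD1 leNgt k1.
Qed.

(** A rational ratio of the [h i] yields an integer relation [A * f 1 = B * f 0], hence [A = B = 0],
    and the columns of the matrix are dependent. The induction passes from [f] to its pull-back [h]
    along [zeta], so [f] is quantified after [k]. *)
Lemma irrational_subst_lengths k :
  (count_mem 0%R (zeta 0%R) * count_mem 1%R (zeta 1%R) !=
   count_mem 0%R (zeta 1%R) * count_mem 1%R (zeta 0%R))%N ->
  forall f : 'I_2 -> R, (forall i, 0 < f i) -> irrational (f 1 / f 0) ->
  irrational (weight f (subst_iter zeta k 1) / weight f (subst_iter zeta k 0)).
Proof.
move=> det; elim: k => [|k IH] f f0 irr; first by rewrite !weight1.
pose h i := weight f (zeta i).
have E i : weight f (subst_iter zeta k.+1 i) = weight h (subst_iter zeta k i).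
  rewrite -(add1n k) subst_iterD weight_subst_pow; apply: eq_bigr => j _.
  by rewrite subst_iter1.
have h0 i : 0 < h i by apply: weight_gt0 => //; exact: subst_neq_nil.
rewrite !E; apply: IH => // -[c _ cE].
have := lt0r_neq0 (h0 0) => h00.
have d0 : (denq c)%:~R != 0 :> R by rewrite intr_eq0 denq_eq0.
have {cE} : (denq c)%:~R * h 1 = (numq c)%:~R * h 0.
  by rewrite -[h 1](divfK h00) -cE /ratr mulrA [(denq c)%:~R * _]mulrC divfK.
rewrite /h !weight2M.
set m00 := count_mem 0%R (zeta 0) in det *;
  set m10 := count_mem 1%R (zeta 0) in det *.
set m01 := count_mem 0%R (zeta 1) in det *;
  set m11 := count_mem 1%R (zeta 1) in det *.
move=> eq.
pose A : int := denq c * m11%:Z - numq c * m10%:Z.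
pose B : int := numq c * m00%:Z - denq c * m01%:Z.
have AB : A%:~R * f 1 = B%:~R * f 0.
  by rewrite /A /B !rmorphB !rmorphM /=; move: eq; lra.
have f00 := lt0r_neq0 (f0 0).
have [A0|A0] := eqVneq A 0; last first.
  apply: irr; exists (B%:~R / A%:~R) => //.
  have A0' : A%:~R != 0 :> R by rewrite intr_eq0.
  rewrite fmorph_div /= !ratr_int; apply: (mulIf f00); rewrite divfK //.
  by apply: (mulfI A0'); rewrite AB mulrA [A%:~R * _]mulrC divfK.
have B0 : B = 0.
  apply/eqP; rewrite -(intr_eq0 R); move: AB; rewrite A0 mul0r => /esym/eqP.
  by rewrite mulf_eq0 (negPf f00) orbF.
move/eqP: det; apply; apply/eqP; rewrite -eqz_nat !PoszM.
have dq : denq c != 0 by rewrite denq_eq0.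
have [p0|p0] := eqVneq (numq c) 0.
  move: A0 B0; rewrite /A /B p0 !mul0r subr0 sub0r => /eqP A0 /eqP B0.
  move: A0 B0; rewrite oppr_eq0 !mulf_eq0 (negPf dq) /= => /eqP-> /eqP->.
  by rewrite mulr0 mul0r.
apply/eqP/(mulfI p0).
have -> : numq c * (m00%:Z * m11%:Z) =
  (B + denq c * m01%:Z) * m11%:Z by rewrite /B; ring.
have -> : numq c * (m01%:Z * m10%:Z) =
  m01%:Z * (denq c * m11%:Z - A) by rewrite /A; ring.
by rewrite A0 B0; ring.
Qed.

Lemma mixing_of_irrational (theta1 theta2 : R) : primitive zeta ->
  subst_space zeta !=set0 ->
  perron_frobenius_pair (subst_mx zeta) theta1 theta2 -> 1 < `|theta2| ->
  irrational ((t 1)%:num / (t 0)%:num) ->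
  topologically_mixing (@tiling_shift R 2 zeta t).
Proof.
move=> /primitive_mem[k0 hk0] [x xX] theta12 theta2_gt1 irr.
move=> U V oU oV [u Uu] [v Vv].
have [phi [eig phi0 phi1]] := second_eigenvector hk0 theta12.
have width := count_width hk0 theta2_gt1 eig phi0 phi1.
have det : (count_mem 0%R (zeta 0%R) * count_mem 1%R (zeta 1%R) !=
   count_mem 0%R (zeta 1%R) * count_mem 1%R (zeta 0%R))%N.
  have := subst_det_neq0 theta12 theta2_gt1.
  by rewrite subr_eq0 -!natrM eqr_nat.
have [a1 [w1 [d1 [aw1 d10 H1]]]] := open_tiling_place oU Uu.
have [a2 [w2 [d2 [aw2 d20 H2]]]] := open_tiling_place oV Vv.
have L1 := (allowedE hk0 w1 xX).1 aw1; have L2 := (allowedE hk0 w2 xX).1 aw2.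
have lt0 i : 0 < len t i by exact: len_gt0.
have dist V1 V2 : language zeta V1 -> language zeta V2 ->
    exists s0 : R, forall s, s0 <= s -> exists m (l : nat),
      [/\ subword x m (size V1) = V1, subword x (m + l%:Z) (size V2) = V2 &
        `|weight (len t) (subword x m l) - s| < d2].
  move=> LV1 LV2.
  have [k1 K1] := language_infix_iter hk0 LV1;
    have [k2 K2] := language_infix_iter hk0 LV2.
  pose k := maxn k1 k2.
  have wpos i := weight_subst_iter_gt0 zeta k i lt0.
  have [B HB] := irrational_window (wpos 0) (wpos 1) d20
    (@irrational_subst_lengths k det _ lt0 irr).
  have [p1 [p2 [s0 Hs0]]] := words_at_distance (D :=
    fun=> True) hk0 xX lt0 d20 width
      (fun s z _ => HB s z) (K1 k 1 (leq_maxl _ _)) (K2 k 0 (leq_maxr _ _)).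
  by exists s0 => s ss; exact: Hs0.
have [s1 D1] := dist w1 w2 L1 L2; have [s2 D2] := dist w2 w1 L2 L1.
(* For either sign of [g], the displacement [g + a1 - a2] required between the two words is then
   beyond both thresholds. *)
exists (`|s1| + `|s2| + `|a1 - a2| + 1).
  by rewrite ltr_wpDl // !addr_ge0.
move=> g gr.
suff [m1 [m2 [E1 E2 m12]]] : exists m1 m2, [/\ subword x m1 (size w1) = w1,
    subword x m2 (size w2) = w2 & `|pos t x m1 - pos t x m2 - (g +
      a1 - a2)| < d2].
  (* The first tiling carries [w1] exactly in place; the whole error is absorbed by the tolerance
     [d2] of the second. *)
  pose c := pos t x m1 - a1.
  exists (translate_tiling c (seq_tiling_set t xX)); split.
    apply: H1; exists 0; first by rewrite normr0.
    have -> : a1 + 0 = pos t x m1 - c by rewrite /c; ring.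
    exact: place_translate_tiling.
  exists (translate_tiling (c - g) (seq_tiling_set t xX)); last first.
    by rewrite tiling_shift_translate subrK.
  apply: H2; exists (pos t x m2 - (c - g) - a2).
    rewrite -normrN; move: m12; congr (`| _ | < _); rewrite /c; ring.
  by rewrite addrC subrK; exact: place_translate_tiling.
have aa := ler_norm (a1 - a2); have aa' :
  - (a1 - a2) <= `|a1 - a2| by rewrite -normrN ler_norm.
have ss1 := ler_norm s1; have ss2 := ler_norm s2.
have n1 := normr_ge0 s1; have n2 := normr_ge0 s2.
have [g0|g0] := leP 0 g.
  rewrite ger0_norm // in gr.
  have [|m [l [E2 E1 h]]] := D2 (g + a1 - a2); first by lra.
  by exists (m + l%:Z), m; split => //; rewrite posD [pos t x m + _]addrC addrK.
rewrite ltr0_norm // in gr.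
have [|m [l [E1 E2 h]]] := D1 (- (g + a1 - a2)); first by lra.
exists m, (m + l%:Z); split => //; rewrite posD -normrN; move: h.
by congr (`| _ | < _); ring.
Qed.

End TwoTiles.

Local Open Scope ring_scope.

Theorem theorem1p2 (R : realType) (zeta : substitution 2) (theta1 theta2 : R)
    (zeta_primitive : primitive zeta)
    (zeta_aperiodic : aperiodic zeta)
    (theta12 : perron_frobenius_pair (subst_mx zeta) theta1 theta2)
    (theta2_gt1 : 1 < `|theta2|) :
  (topologically_mixing (@subst_shift 2 zeta) <->
   forall n : nat, (1 <= n)%N ->
     gcdn (size (subst_iter zeta n 0)) (size (subst_iter zeta n 1)) = 1%N) /\
  (forall t : 'I_2 -> {posnum R},
     topologically_mixing (@tiling_shift R 2 zeta t) <->
     irrational ((t 1)%:num / (t 0)%:num)).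
Proof.
have X0 := aperiodic_nonempty zeta_aperiodic.
split=> [|t]; split.
- by move=> mix n _; exact: gcd_of_mixing.
- exact: mixing_of_gcd theta12 theta2_gt1.
- exact: irrational_of_mixing.
- exact: mixing_of_irrational theta12 theta2_gt1.
Qed.
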